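(* Let $K\subset\mathbb{R}^{n}$ be a convex body in isotropic position and let $X\sim Uni(K)$ be a random vector uniformly distributed over $K$. Let $\Delta_n\subset\mathbb{R}^n$ be an $n$-dimensional simplex in isotropic position and let $\Gamma_n\sim Uni(\Delta_n)$. Then for any $k\in\{3,4\}$ and any $\phi\in C^{k}(\mathbb{R})$ such that $\phi^{(k)}(x)>0$ for all $x\in\mathbb{R}$, we have $$\max_{\theta\in S^{n-1}}\mathbb{E}[\phi(X\cdot\theta)]\leq\max_{\theta\in S^{n-1}}\mathbb{E}[\phi(\Gamma_{n}\cdot\theta)].$$
   Context: A convex body in $\mathbb{R}^n$ is a compact convex set with non-empty interior. $Uni(K)$ is the uniform distribution on $K$. A random vector $X=(X_1,\ldots,X_n)$ is in isotropic position if $\mathbb{E}[X]=0$ and $\mathbb{E}[X_iX_j]=\delta_{i,j}$ for all $1\le i,j\le n$. A convex body $K$ is in isotropic position if $X\sim Uni(K)$ is in isotropic position. $S^{n-1}$ is the unit sphere of $\mathbb{R}^n$ centered at the origin. *)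

(* Defs.v *)
From HB Require Import structures.
From mathcomp Require Import all_boot all_order all_algebra.
From mathcomp Require Import all_classical all_reals all_analysis.

Set Implicit Arguments.
Unset Strict Implicit.
Unset Printing Implicit Defensive.

Import Order.TTheory GRing.Theory Num.Theory.
Import numFieldNormedType.Exports.

Local Open Scope classical_set_scope.
Local Open Scope ring_scope.

(* R^n is 'rV[R]_n, with the sigma-algebra generated by the coordinates (as the
   library does for n.-tuple T). Since the topology has a countable basis of
   boxes, this is the Borel sigma-algebra. *)
Definition measure_rV_display : measure_display -> measure_display.
Proof. exact. Qed.

Section measurable_rV.
Context {R : realType} {n : nat}.

Let coors : 'I_n -> 'rV[R]_n -> R := fun i x => x ord0 i.

Let rV_set0 : g_sigma_preimage coors set0.
Proof. exact: sigma_algebra0. Qed.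

Let rV_setC A : g_sigma_preimage coors A -> g_sigma_preimage coors (~` A).
Proof. exact: sigma_algebraC. Qed.

Let rV_bigcup (F : _^nat) : (forall i, g_sigma_preimage coors (F i)) ->
  g_sigma_preimage coors (\bigcup_i (F i)).
Proof. exact: sigma_algebra_bigcup. Qed.

HB.instance Definition _ := @isMeasurable.Build
  (measure_rV_display default_measure_display)
  'rV[R]_n (g_sigma_preimage coors) rV_set0 rV_setC rV_bigcup.

End measurable_rV.

Lemma measurable_coord (R : realType) n (i : 'I_n) :
  measurable_fun [set: 'rV[R]_n] (fun x : 'rV[R]_n => x ord0 i).
Proof.
move=> _ Y mY; rewrite setTI; apply: sub_sigma_algebra => /=.
rewrite -bigcup_seq/=; exists i => /=; first by rewrite mem_index_enum.
by exists Y => //; rewrite setTI.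
Qed.

Lemma measurable_fun_coordP d (T : measurableType d) (R : realType) n
    (f : T -> 'rV[R]_n) :
  measurable_fun [set: T] f <->
  forall i, measurable_fun [set: T] (fun t => f t ord0 i).
Proof.
split=> [mf i|mf].
  exact: (measurableT_comp (@measurable_coord R n i)).
pose c := fun (i : 'I_n) (x : 'rV[R]_n) => x ord0 i.
suff fS : g_sigma_preimage (fun i => c i \o f) `<=` measurable.
  move=> _ A mA; apply: fS.
  by rewrite (@g_sigma_preimage_comp _ R n 'rV[R]_n c); exists A.
apply: smallest_sub; first exact: sigma_algebra_measurable.
case: n => [|n] in f mf c *; first by rewrite big_ord0.
rewrite -bigcup_mkord_ord; apply: bigcup_sub => i Ii.
by move=> A [B mB <-]; exact: mf.
Qed.

Definition consrV (R : realType) n (p : R * 'rV[R]_n) : 'rV[R]_n.+1 :=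
  row_mx (const_mx p.1 : 'rV[R]_1) p.2.

Definition unconsrV (R : realType) n (x : 'rV[R]_n.+1) : R * 'rV[R]_n :=
  (x ord0 ord0, rsubmx (x : 'rV[R]_(1 + n))).

Lemma consrVK (R : realType) n : cancel (@consrV R n) (@unconsrV R n).
Proof.
move=> [a v]; rewrite /consrV /unconsrV /= row_mxKr; congr pair.
rewrite mxE; case: splitP => [j _|j //]; exact: mxE.
Qed.

Lemma measurable_consrV (R : realType) n :
  measurable_fun [set: R * 'rV[R]_n] (@consrV R n).
Proof.
apply/measurable_fun_coordP => i; rewrite /consrV.
under eq_fun do rewrite mxE.
case: splitP => j _.
- under eq_fun do rewrite mxE.
  exact: measurable_fst.
- exact: (measurableT_comp (@measurable_coord R n j) measurable_snd).
Qed.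

Lemma measurable_unconsrV (R : realType) n :
  measurable_fun [set: 'rV[R]_n.+1] (@unconsrV R n).
Proof.
apply: measurable_fun_pair; first exact: measurable_coord.
apply/measurable_fun_coordP => i; under eq_fun do rewrite mxE.
exact: (@measurable_coord R n.+1 (rshift 1 i)).
Qed.

Section lebesgue_succ.
Context {R : realType} {n : nat}.
Variable mu : {sigma_finite_measure set 'rV[R]_n -> \bar R}.
Local Open Scope ereal_scope.

Definition lebesgue_succ : set 'rV[R]_n.+1 -> \bar R :=
  pushforward (lebesgue_measure \x mu) (@consrV R n).

Let lebesgue_succ0 : lebesgue_succ set0 = 0.
Proof. by rewrite /lebesgue_succ /pushforward preimage_set0 measure0. Qed.

Let lebesgue_succ_ge0 A : 0 <= lebesgue_succ A.
Proof. by rewrite /lebesgue_succ /pushforward measure_ge0. Qed.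

Let lebesgue_succ_sigma_additive : semi_sigma_additive lebesgue_succ.
Proof.
move=> F mF tF mUF; rewrite /lebesgue_succ /pushforward preimage_bigcup.
have mp A : measurable A -> measurable (@consrV R n @^-1` A).
  by move=> mA; rewrite -[X in measurable X]setTI; exact: measurable_consrV.
apply: measure_semi_sigma_additive.
- by move=> k; exact: mp.
- apply/trivIsetP => /= i j _ _ ij; rewrite -preimage_setI.
  by move/trivIsetP : tF => /(_ _ _ _ _ ij) ->//; rewrite preimage_set0.
- by rewrite -preimage_bigcup; exact: mp.
Qed.

HB.instance Definition _ := isMeasure.Build _ _ _ lebesgue_succ
  lebesgue_succ0 lebesgue_succ_ge0 lebesgue_succ_sigma_additive.

Let lebesgue_succ_sigma_finite : sigma_finite setT lebesgue_succ.
Proof.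
have /sigma_finiteP[F [FT ndF Foo]] := sigma_finiteT (@lebesgue_measure R).
have /sigma_finiteP[G [GT ndG Goo]] := sigma_finiteT mu.
exists (fun k => @unconsrV R n @^-1` (F k `*` G k)).
  rewrite -preimage_bigcup -[LHS](preimage_setT (@unconsrV R n)).
  congr (_ @^-1` _); rewrite -setXTT FT GT predeqE => -[x y]; split.
    move=> [/= [k _ Fkx] [l _ Gly]]; exists (maxn k l) => //; split.
    - by move: x Fkx; exact/subsetPset/ndF/leq_maxl.
    - by move: y Gly; exact/subsetPset/ndG/leq_maxr.
  by move=> [k _ []/= ? ?]; split; exists k.
move=> k; have [mFk Fk] := Foo k; have [mGk Gk] := Goo k; split.
  rewrite -[X in measurable X]setTI.
  by apply: measurable_unconsrV => //; exact: measurableX.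
rewrite /lebesgue_succ /pushforward -comp_preimage.
rewrite (_ : _ \o _ = id); last by apply/funext => p /=; rewrite consrVK.
by rewrite preimage_id product_measure1E// lte_mul_pinfty// ge0_fin_numE.
Qed.

HB.instance Definition _ := Measure_isSigmaFinite.Build _ _ _ lebesgue_succ
  lebesgue_succ_sigma_finite.

End lebesgue_succ.

Fixpoint lebesgue_rV (R : realType) n :
    {sigma_finite_measure set 'rV[R]_n -> \bar R} :=
  match n return {sigma_finite_measure set 'rV[R]_n -> \bar R} with
  | 0%N => @dirac _ 'rV[R]_0 0 R
  | m.+1 => @lebesgue_succ R m (lebesgue_rV R m)
  end.

(* Together with uniqueness, this identifies lebesgue_rV with the Lebesgue
   measure. *)
Lemma lebesgue_rV_box (R : realType) n (A : 'I_n -> set R) :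
  (forall i, measurable (A i)) ->
  (lebesgue_rV R n [set x | forall i, A i (x ord0 i)] =
   \prod_(i < n) lebesgue_measure (A i))%E.
Proof.
elim: n A => [|n IH] A mA.
  by rewrite big_ord0 /= diracE mem_set// => -[].
have mB : measurable
    [set x : 'rV[R]_n | forall i, A (lift ord0 i) (x ord0 i)].
  rewrite (_ : [set _ | _] = ~` \big[setU/set0]_(i < n)
      ((fun x : 'rV[R]_n => x ord0 i) @^-1` ~` A (lift ord0 i))).
    apply: measurableC; apply: bigsetU_measurable => i _.
    rewrite -[X in measurable X]setTI; apply: measurable_coord => //.
    exact: measurableC.
  apply/seteqP; split=> x /=; rewrite -bigcup_seq.
    by move=> Ax [i _]; apply; exact: Ax.
  move=> nAx i; apply: contrapT => nAi; apply: nAx; exists i => //=.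
  exact: mem_index_enum.
rewrite big_ord_recl -IH//= /lebesgue_succ /pushforward -product_measure1E//;
  last exact: mA.
congr (_ _); apply/seteqP; split=> -[a v] /=; rewrite /consrV.
  move=> Aav; split=> [|i].
    by have := Aav ord0; rewrite mxE; case: splitP => // j _; rewrite mxE.
  have := Aav (lift ord0 i); rewrite mxE; case: splitP => [[]//[]//|j].
  by rewrite lift0 => -[/val_inj ->].
move=> [Aa Av] i; rewrite mxE; case: splitP => j ij.
  by rewrite mxE (_ : i = ord0)//; apply: val_inj; rewrite /= ij ord1.
by rewrite (_ : i = lift ord0 j)//; exact: val_inj.
Qed.

Definition dotp (R : realType) n (x y : 'rV[R]_n) : R :=
  \sum_(i < n) x ord0 i * y ord0 i.

(* The library norm `|x| on 'rV[R]_n is the sup norm, hence this definition. *)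
Definition eucl_norm (R : realType) n (x : 'rV[R]_n) : R :=
  Num.sqrt (dotp x x).

Definition unit_sphere (R : realType) n : set 'rV[R]_n :=
  [set x | eucl_norm x = 1].
Arguments unit_sphere : clear implicits.

Definition convex_body (R : realType) n (K : set 'rV[R]_n) : Prop :=
  [/\ compact K, convex_set (K : set (convex_lmodType 'rV[R]_n))
    & interior K !=set0].

Definition affinely_independent (R : realType) n m (v : 'I_m -> 'rV[R]_n) :
    Prop :=
  forall c : 'I_m -> R, \sum_i c i = 0 -> \sum_i c i *: v i = 0 ->
    forall i, c i = 0.

Definition convex_hull (R : realType) n m (v : 'I_m -> 'rV[R]_n) :
    set 'rV[R]_n :=
  [set x | exists c : 'I_m -> R,
    [/\ forall i, 0 <= c i, \sum_i c i = 1 & x = \sum_i c i *: v i]].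

Definition full_simplex (R : realType) n (D : set 'rV[R]_n) : Prop :=
  exists v : 'I_n.+1 -> 'rV[R]_n,
    affinely_independent v /\ D = convex_hull v.

Definition uniform_on (R : realType) n (K : set 'rV[R]_n)
    d (T : measurableType d) (P : probability T R)
    (X : {RV P >-> 'rV[R]_n}) : Prop :=
  forall A : set 'rV[R]_n, measurable A ->
    distribution P X A = (lebesgue_rV R n (A `&` K) / lebesgue_rV R n K)%E.

Definition isotropic_rv (R : realType) n d (T : measurableType d)
    (P : probability T R) (X : {RV P >-> 'rV[R]_n}) : Prop :=
  (forall i, 'E_P[fun t => X t ord0 i] = 0)%E /\
  (forall i j,
    'E_P[fun t => (X t ord0 i * X t ord0 j)%R] = ((i == j)%:R)%:E)%E.

(* Whether a random vector is isotropic depends only on its law, so that the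
   choice of the vector uniformly distributed over K is irrelevant. *)
Definition isotropic_body (R : realType) n (K : set 'rV[R]_n) : Prop :=
  forall d (T : measurableType d) (P : probability T R)
    (X : {RV P >-> 'rV[R]_n}), uniform_on K X -> isotropic_rv X.

Definition class_C (R : realType) (k : nat) (phi : R -> R) : Prop :=
  (forall j, (j < k)%N -> forall x : R, derivable (derive1n j phi) x 1) /\
  continuous (derive1n k phi).

Definition is_max_over (I : Type) (R : realType) (S : set I) (f : I -> \bar R)
    (m : \bar R) : Prop :=
  (exists2 x, S x & f x = m) /\ (forall x, S x -> (f x <= m)%E).

(* Main.v *)
Require Import Defs.
From HB Require Import structures.
From mathcomp Require Import all_boot all_order all_algebra.
From mathcomp Require Import all_classical all_reals all_analysis.
From mathcomp Require Import finmap measurable_realfun ring lra.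
Import Order.TTheory GRing.Theory Num.Theory.
Import numFieldNormedType.Exports.
Local Open Scope classical_set_scope.
Local Open Scope ring_scope.

Set Implicit Arguments.
Unset Strict Implicit.
Unset Printing Implicit Defensive.

(* Comparing densities. Let [F] be the density of [X . theta] and [m = n - 1].
   By Brunn-Minkowski in the hyperplane slices, [F ^ (1 / m)] is concave on the
   support of [F]. If the linear form [u] sends all vertices of the simplex
   but two to one value [z], and these two to [p <= z] and [q >= z], the slices
   of the simplex are homothetic to the one at [z], so the density [g] of
   [Gamma . u] is the [m]-th power of an affine function on [p, z] and on
   [z, q]. Hence [F - g] has the sign pattern [- + - + -], and [+ - + -] when
   [p = z].

   When [p = z], isotropy makes the moments of order 0, 1, 2 agree; subtracting
   from [phi] the quadratic polynomial interpolating it at the three sign changes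
   makes the integrand [(phi - q) (F - g)] nonpositive, which settles [k = 3].
   Applied to the cube function in two opposite directions, the case [k = 3]
   also brackets the third moment of [X . theta] between those of two such
   degenerate forms. Rotating one into the other through forms of the above
   kind, the intermediate value theorem gives a [u] with the same third moment,
   and interpolation at four sign changes settles [k = 4]. For [n = 1] the
   density is constant on an interval and is determined by its moments. *)

(** * Interpolation and sign changes *)

(** Origin of the sign pattern: on each side of [z] the tent is a constant times the [m]-th power of
    the positive part of an affine function, while [F ^ (1 / m)] is concave, so [F >= g] holds on an
    interval. Each side thus reads - + -, and the two inner minus signs merge. Interpolation at [k]
    nodes costs [k] vanishing moments of [F - g], those of order 0 to [k - 1]. Isotropy supplies
    three. The fourth is obtained by choosing the direction, along a path from [w b] to [- w a],
    where [w i] is normal to the facet opposite the vertex [v i]: the end points are oriented so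
    that the simplex tapers to opposite sides. The interpolation error has the sign of the node
    polynomial only for distinct nodes. If nodes coincide, there are fewer sign changes than
    vanishing moments, which forces [F = g] almost everywhere; so Hermite interpolation is avoided.
    Roots are avoided as well: concavity of [F ^ (1 / m)] and Brunn-Minkowski are stated through
    bounds [c * a ^+ m <= F x] with a free factor [c]. This form passes through the induction on the
    dimension and still makes sense for [m = 0]. *)

Section rolle.
Context {R : realType}.
Implicit Types (f g : R -> R) (z : seq R) (q : {poly R}).

Lemma Rolle_zero f a b : a < b -> (forall x, derivable f x 1) ->
  f a = 0 -> f b = 0 -> exists2 c, a < c < b & (f^`())%classic c = 0.
Proof.
move=> ab df fa fb.
have [c cab fc] : exists2 c, c \in `]a, b[%R & is_derive c 1 f 0.
  apply: Rolle => //; last by rewrite fa fb.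
  apply: derivable_within_continuous => x _; exact: df.
exists c; first by rewrite in_itv/= in cab.
by rewrite derive1E; exact: derive_val.
Qed.

Lemma Rolle_zeros f z x : (forall t, derivable f t 1) ->
  path <%R x z -> (forall t, t \in x :: z -> f t = 0) ->
  exists s, [/\ size s = size z, sorted <%R s,
    (forall t, t \in s -> x < t) & forall t, t \in s -> (f^`())%classic t = 0].
Proof.
move=> df; elim: z x => [x _ _|y z IH x /= /andP[xy yz] fz].
  by exists [::].
have [t|s [szs ss ys fs]] := IH y yz.
  by move=> tz; apply: fz; rewrite inE tz orbT.
have [c /andP[xc cy] fc] : exists2 c, x < c < y & (f^`())%classic c = 0.
  by apply: Rolle_zero => //; apply: fz; rewrite !inE eqxx ?orbT.
exists (c :: s); split => /=; first by rewrite szs.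
- rewrite (path_sortedE lt_trans) ss andbT; apply/allP => t /ys; exact: lt_trans.
- move=> t; rewrite inE => /orP[/eqP->//|/ys]; apply: lt_trans.
  exact: lt_trans cy.
- by move=> t; rewrite inE => /orP[/eqP->|/fs].
Qed.

Lemma Rolle_iter f k z :
  (forall j, (j < k)%N -> forall t, derivable (f^`(j))%classic t 1) ->
  sorted <%R z -> size z = k.+1 -> (forall t, t \in z -> f t = 0) ->
  exists t, (f^`(k))%classic t = 0.
Proof.
elim: k f z => [|k IH] f z df sz szz fz.
  by case: z szz fz sz => // t z _ fz _; exists t; apply: fz; rewrite inE eqxx.
case: z szz fz sz => // x z [szz] fz xz.
have [|s [szs ss _ fs]] := @Rolle_zeros f z x _ xz fz.
  by move=> t; have := df 0%N (ltn0Sn _) t.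
have szk : size s = k.+1 by rewrite szs.
have [|t ft] := IH f^`()%classic s _ ss szk fs.
  by move=> j jk t; rewrite -derive1Sn; exact: df.
by exists t; rewrite derive1Sn.
Qed.

Lemma interpolation f z : uniq z ->
  exists2 q : {poly R}, (size q <= size z)%N & forall t, t \in z -> q.[t] = f t.
Proof.
elim: z => [_|x z IH /= /andP[xz uz]].
  by exists 0 => //; rewrite size_poly0.
have [q szq qz] := IH uz.
pose w := \prod_(t <- z) ('X - t%:P).
have wx : w.[x] != 0.
  rewrite /w horner_prod prodf_seq_neq0; apply/allP => t tz /=.
  by rewrite hornerXsubC subr_eq0; apply: contraNneq xz => ->.
exists (q + ((f x - q.[x]) / w.[x]) *: w).
  rewrite (leq_trans (size_polyD _ _))// geq_max (leq_trans szq)//=.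
  by rewrite (leq_trans (size_scale_leq _ _))// size_prod_XsubC.
move=> t; rewrite inE hornerD hornerZ => /orP[/eqP->|tz].
  by rewrite divfK// subrKC.
have -> : w.[t] = 0.
  by apply/eqP; rewrite -[_ == _]/(root w t) root_prod_XsubC.
by rewrite mulr0 addr0 qz.
Qed.

Lemma derivable_subpoly f k q : class_C k f ->
  forall j, (j <= k)%N ->
  ((fun t => f t - q.[t])^`(j))%classic =
    (fun t => f^`(j)%classic t - (q^`(j)).[t]) /\
  ((j < k)%N -> forall t,
    derivable ((fun t => f t - q.[t])^`(j))%classic t 1).
Proof.
move=> [df _] j jk.
have E : ((fun t => f t - q.[t])^`(j))%classic =
    (fun t => f^`(j)%classic t - (q^`(j)).[t]).
  elim: j jk => [//|j IH jk]; rewrite derive1nS IH; last exact: ltnW.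
  apply/funext => t.
  rewrite derive1E [LHS](@deriveB _ _ _ f^`(j)%classic (horner (q^`(j)%R)))//.
  - by rewrite derivnS derivE !derive1E derive1nS derive1E.
  - exact: df.
split=> // {}jk t; rewrite E.
apply: (@derivableB _ _ _ f^`(j)%classic (horner (q^`(j)%R))).
- exact: df.
- exact: derivable_horner.
Qed.

(** The Lagrange error formula: away from the nodes [c] is [f^(k)(s) / k!] for some [s] depending on
    [t]; at a node [c = 0] serves. *)
Lemma interpolation_sign f k z : class_C k f ->
  (forall x, 0 < f^`(k)%classic x) -> uniq z -> size z = k ->
  exists2 q : {poly R}, (size q <= k)%N &
    forall t, exists2 c, 0 <= c & f t - q.[t] = c * \prod_(x <- z) (t - x).
Proof.
move=> fk f_gt0 uz szz.
have [q szq qz] := interpolation f uz.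
exists q; rewrite -?szz// => t.
have [tz|tz] := boolP (t \in z).
  by exists 0; rewrite ?qz ?subrr ?mul0r.
pose w := \prod_(x <- z) ('X - x%:P).
have wE s : w.[s] = \prod_(x <- z) (s - x).
  by rewrite /w horner_prod; under eq_bigr do rewrite hornerXsubC.
have wt : w.[t] != 0.
  by rewrite -[_ == _]/(root w t) root_prod_XsubC.
(* This [c] makes [f - (q + c *: w)] vanish at [t] too. With [k.+1] zeros, its [k]-th derivative,
   which is [f^(k) - c * k!], has a zero. *)
pose c := (f t - q.[t]) / w.[t].
have ct : f t - q.[t] = c * w.[t] by rewrite divfK.
have zeros s : s \in t :: z -> f s - (q + c *: w).[s] = 0.
  rewrite hornerD hornerZ inE => /orP[/eqP->|sz].
    by rewrite opprD addrA ct subrr.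
  have -> : w.[s] = 0.
    by apply/eqP; rewrite -[_ == _]/(root w s) root_prod_XsubC.
  by rewrite mulr0 addr0 qz// subrr.
have [||||s] := @Rolle_iter (fun s => f s - (q + c *: w).[s]) k
    (sort <=%R (t :: z)).
- by move=> j jk s; apply: (derivable_subpoly (q + c *: w) fk (ltnW jk)).2.
- by rewrite sort_lt_sorted/= tz uz.
- by rewrite size_sort/= szz.
- by move=> s; rewrite mem_sort; exact: zeros.
rewrite (derivable_subpoly (q + c *: w) fk (leqnn k)).1.
rewrite derivnD derivnZ hornerD hornerZ.
have -> : q^`(k) = 0.
  by apply: derivn_poly0; rewrite -szz.
have wk : (w^`(k)).[s] = (k`!)%:R.
  rewrite -[w](addrNK 'X^k) derivnD.
  have -> : (w - 'X^k)^`(k) = 0.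
    apply: derivn_poly0.
    have wm : w \is monic by exact: monic_prod_XsubC.
    have szw : size w = k.+1 by rewrite size_prod_XsubC szz.
    apply/leq_sizeP => j; rewrite leq_eqVlt coefB coefXn => /orP[/eqP<-|kj].
      by rewrite eqxx -[X in w`_X]/(k.+1.-1) -szw -lead_coefE (monicP wm) subrr.
    by rewrite gtn_eqF// nth_default ?szw// subr0.
  by rewrite add0r derivnXn subnn expr0 hornerMn hornerC ffactnn.
rewrite horner0 add0r wk => /eqP; rewrite subr_eq0 => /eqP fks.
have c0 : 0 < c.
  rewrite -(@pmulr_lgt0 _ (k`!)%:R) ?ltr0n ?fact_gt0// -fks.
  exact: f_gt0.
by exists c; [exact: ltW|rewrite -wE].
Qed.

End rolle.

(** * Sign changes against vanishing moments *)

Section sign_patterns.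
Context {R : realType}.
Local Notation leb := (@lebesgue_measure R).
Implicit Types (f g u psi : R -> R) (z s : seq R).

Definition integrable_vs_continuous u := forall psi, continuous psi ->
  leb.-integrable setT (fun t => (psi t * u t)%:E).

Lemma integral_poly_eq0 u k (q : {poly R}) : integrable_vs_continuous u ->
  (forall j, (j < k)%N -> \int[leb]_t (t ^+ j * u t)%:E = 0)%E ->
  (size q <= k)%N -> (\int[leb]_t (q.[t] * u t)%:E = 0)%E.
Proof.
move=> iu mom szq.
have -> : (fun t => (q.[t] * u t)%:E) =
    (fun t => \sum_(i < size q) ((q`_i)%:E * (t ^+ i * u t)%:E))%E.
  apply/funext => t; rewrite horner_coef mulr_suml -sumEFin.
  by apply: eq_bigr => i _; rewrite -mulrA.
have iX j : leb.-integrable setT (fun t => (t ^+ j * u t)%:E).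
  by apply: iu => x; exact: exprn_continuous.
rewrite integral_sum//; last by move=> i; exact: integrableZl.
rewrite big1// => i _; rewrite integralZl// mom ?mule0//.
exact: leq_trans (ltn_ord i) szq.
Qed.

Lemma ae_finite s (A : R -> Prop) : (forall t, t \notin s -> A t) ->
  {ae leb, forall t, A t}.
Proof.
move=> sA; exists [set` s]; split.
- exact: (countable_measurable _ (finite_set_countable (finite_seq s))).
- exact/countable_lebesgue_measure0/finite_set_countable/finite_seq.
- by move=> t /= nA; apply: contrapT => /negP/sA.
Qed.

Lemma integral_eq0_ae u s : leb.-integrable setT (EFin \o u) ->
  (forall t, t \notin s -> u t <= 0) -> (\int[leb]_t (u t)%:E = 0)%E ->
  {ae leb, forall t, u t = 0}.
Proof.
move=> iu u0 iu0; have mu := measurable_int _ iu.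
have mru : measurable_fun [set: R] u by exact/measurable_EFinP.
have : (\int[leb]_t `|(u t)%:E| = 0)%E.
  transitivity (\int[leb]_t ((- 1)%:E * (u t)%:E))%E.
    apply: ae_eq_integral => //.
    - by apply/measurable_EFinP; exact: measurableT_comp.
    - by apply/measurable_EFinP; exact: measurable_funM.
    - apply: (@ae_finite s) => t ts _.
      by rewrite abse_EFin ler0_norm ?u0// -EFinM mulN1r.
  by rewrite integralZl// iu0 mule0.
move=> /(ae_eq_integral_abs leb measurableT mu).
by apply: filterS => t /(_ I) [].
Qed.

(** With one more vanishing moment than sign changes, the monic polynomial with roots [z] can itself
    be integrated against [u]: the product has constant sign and integral 0. The exceptional points
    [s] make room for a double node that has been cancelled. *)
Lemma sign_pattern_ae0 u z s : integrable_vs_continuous u ->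
  (forall j, (j <= size z)%N -> \int[leb]_t (t ^+ j * u t)%:E = 0)%E ->
  (forall t, t \notin s -> \prod_(x <- z) (t - x) * u t <= 0) ->
  {ae leb, forall t, u t = 0}.
Proof.
move=> iu mom pat.
pose w := \prod_(x <- z) ('X - x%:P).
have wE t : w.[t] = \prod_(x <- z) (t - x).
  by rewrite /w horner_prod; under eq_bigr do rewrite hornerXsubC.
have : {ae leb, forall t, w.[t] * u t = 0}.
  apply: (@integral_eq0_ae _ s).
  - by apply: iu; exact: continuous_horner.
  - by move=> t /pat; rewrite wE.
  - apply: (integral_poly_eq0 (k := (size z).+1)) => //.
    by rewrite size_prod_XsubC.
have : {ae leb, forall t, w.[t] != 0}.
  apply: (@ae_finite z) => t tz.
  by rewrite -[_ == _]/(root w t) root_prod_XsubC.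
apply: filterS2; first exact: (ae_filter_ringOfSetsType leb).
move=> t w0 /eqP.
by rewrite mulf_eq0 (negbTE w0) => /eqP.
Qed.

Lemma integral_ae0 u psi : integrable_vs_continuous u -> continuous psi ->
  {ae leb, forall t, u t = 0} -> (\int[leb]_t (psi t * u t)%:E = 0)%E.
Proof.
move=> iu cpsi u0; rewrite -[RHS](integral0 leb [set: R]).
apply: ae_eq_integral => //; first exact: measurable_int (iu _ cpsi).
move: u0; apply: filterS; first exact: (ae_filter_ringOfSetsType leb).
by move=> t -> _; rewrite mulr0.
Qed.

Lemma sign_pattern_le0 u k phi z : (0 < k)%N -> class_C k phi ->
  (forall x, 0 < phi^`(k)%classic x) -> integrable_vs_continuous u ->
  (forall j, (j < k)%N -> \int[leb]_t (t ^+ j * u t)%:E = 0)%E ->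
  size z = k ->
  (forall t, \prod_(x <- z) (t - x) * u t <= 0) ->
  (\int[leb]_t (phi t * u t)%:E <= 0)%E.
Proof.
move=> k0 phik phi_gt0 iu mom szz pat.
have cphi : continuous phi.
  move=> x; apply/differentiable_continuous/derivable1_diffP.
  exact: (phik.1 0%N).
have [uz|] := boolP (uniq z).
  have [q szq qphi] := interpolation_sign phik phi_gt0 uz szz.
  rewrite -(integral_poly_eq0 iu mom szq).
  apply: le_integral => //; first exact: iu.
    by apply: iu; exact: continuous_horner.
  move=> t _; rewrite lee_fin -subr_le0 -mulrBl.
  have [c c0 ->] := qphi t.
  by rewrite -mulrA mulr_ge0_le0.
move/(uniqPn 0) => [i [j [ij jz xij]]].
pose x := nth 0 z i.
pose z' := rem x (rem x z).
have xz : x \in z by rewrite mem_nth// (ltn_trans ij).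
have zE : perm_eq z (x :: rem x z) by exact: perm_to_rem.
(* The indices [i < j] put one occurrence of [x] in [take j z] and another in [drop j z], so [x]
   survives the removal of one copy. *)
have xz1 : x \in rem x z.
  rewrite -has_pred1 has_count -(ltn_add2l 1).
  have := permP zE (pred1 x); rewrite /= eqxx => <-.
  rewrite addn0 -(cat_take_drop j z) count_cat.
  have jt : (i < size (take j z))%N by rewrite size_take jz.
  apply: (@leq_add 1 1); rewrite -has_count has_pred1.
    by rewrite /x -(nth_take _ ij) mem_nth.
  by rewrite /x xij -[j in nth _ _ j]addn0 -nth_drop mem_nth// size_drop subn_gt0.
have z1E : perm_eq (rem x z) (x :: z') by exact: perm_to_rem.
have szz' : (size z').+2 = k.
  by rewrite -szz (perm_size zE)/= (perm_size z1E).
(* a repeated node does not change signs, leaving fewer changes than moments *)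
rewrite integral_ae0//; apply: (@sign_pattern_ae0 _ z' [:: x]) => //.
  by move=> l lz'; apply: mom; rewrite -szz' ltnS ltnW.
move=> t; rewrite inE => tx; have := pat t.
rewrite (perm_big _ zE)/= big_cons (perm_big _ z1E)/= big_cons mulrA -expr2.
by rewrite -mulrA pmulr_rle0// exprn_even_gt0//= subr_eq0.
Qed.

End sign_patterns.

(** * Power-concave functions against tents *)

Section tents.
Context {R : realType}.
Implicit Types (F g u : R -> R) (S : set R).

(* [F ^ (1 / m)] is concave on the support of [F], stated without roots *)
Definition power_concave m F := forall x y l a b c : R,
  0 < l < 1 -> 0 < a -> 0 < b -> 0 < c ->
  c * a ^+ m <= F x -> c * b ^+ m <= F y ->
  c * ((1 - l) * a + l * b) ^+ m <= F ((1 - l) * x + l * y).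

(** The nodes are the infimum and supremum of [S]. Whether [S] contains them is irrelevant, since
    the product vanishes there. For empty [S], a double node makes the factor a square. *)
Lemma interval_nodes S (lo hi : R) : lo <= hi ->
  (forall t, S t -> lo <= t <= hi) ->
  (forall x y t, S x -> S y -> x < t < y -> S t) ->
  exists s1 s2 : R, [/\ lo <= s1, s1 <= s2, s2 <= hi & forall u t,
    (S t -> 0 <= u t) -> (~ S t -> u t <= 0) ->
    (t - s1) * (t - s2) * u t <= 0].
Proof.
move=> lohi Sb Sc; have [S0|nS0] := pselect (S !=set0); last first.
  exists lo, lo; split=> // u t _ ut; rewrite mulr_ge0_le0 -?expr2 ?sqr_ge0//.
  by apply: ut => St; apply: nS0; exists t.
have infS : has_inf S by split=> //; exists lo => t /Sb /andP[].
have supS : has_sup S by split=> //; exists hi => t /Sb /andP[].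
exists (inf S), (sup S).
have le_s t : S t -> inf S <= t <= sup S.
  move=> St; apply/andP; split; first exact: (ge_inf infS.2 St).
  exact: (ub_le_sup supS.2 St).
case: S0 => x0 Sx0.
have [i0 s0] : inf S <= x0 /\ x0 <= sup S by apply/andP/le_s.
split.
- by apply: lb_le_inf; [exists x0|move=> t /Sb /andP[]].
- exact: le_trans s0.
- by apply: sup_le_ub; [exists x0|move=> t /Sb /andP[]].
move=> u t ut nut; have [St|nSt] := pselect (S t).
  have /andP[? ?] := le_s _ St.
  by rewrite mulr_le0_ge0 ?ut// mulr_ge0_le0// ?subr_ge0// subr_le0.
rewrite mulr_ge0_le0 ?nut//.
have [ti|it] := leP t (inf S).
  rewrite mulr_le0// subr_le0// (le_trans ti)// (le_trans i0)//.
have [st|ts] := leP (sup S) t.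
  by rewrite mulr_ge0// subr_ge0// ltW.
have [x Sx xt] := inf_lt infS.1 it.
have [y Sy ty] := sup_gt supS.1 ts.
by case: nSt; apply: (Sc x y) => //; rewrite xt ty.
Qed.

(** Superlevel sets of a concave function minus an affine one are convex; this is that fact for
    [(F / c) ^ (1 / m)], with the affine function truncated at 0. *)
Lemma power_concave_ge_affine m F (k h c : R) x y t : (0 < m)%N -> 0 < c ->
  power_concave m F -> x < t < y -> 0 < F x -> 0 < F y ->
  c * Num.max (k * x + h) 0 ^+ m <= F x ->
  c * Num.max (k * y + h) 0 ^+ m <= F y ->
  0 < F t /\ c * Num.max (k * t + h) 0 ^+ m <= F t.
Proof.
move=> m0 c0 FQ /andP[xt ty] Fx Fy cx cy.
(* [power_concave] admits positive bases only. Where the affine function is nonpositive, a small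
   positive base replaces it; capping it at 1 gives [a ^+ m <= a]. *)
have lift w s : 0 < F s -> c * Num.max w 0 ^+ m <= F s ->
    exists2 a, 0 < a & w <= a /\ c * a ^+ m <= F s.
  move=> Fs; have [w0 _|w0 cw] := leP w 0; last by exists w.
  have e0 : 0 < Num.min 1 (F s / c) by rewrite lt_min ltr01 divr_gt0.
  exists (Num.min 1 (F s / c)) => //; split; first exact: le_trans (ltW e0).
  rewrite mulrC -ler_pdivlMr//.
  apply: (@le_trans _ _ (Num.min 1 (F s / c))); last by rewrite ge_min lexx orbT.
  by rewrite -[leRHS]expr1 ler_wiXn2l ?ge_min ?lexx// ltW.
have [a a0 [xa ca]] := lift _ _ Fx cx.
have [b b0 [yb cb]] := lift _ _ Fy cy.
have yx : 0 < y - x by rewrite subr_gt0 (lt_trans xt).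
pose l := (t - x) / (y - x).
have l0 : 0 < l by rewrite divr_gt0// subr_gt0.
have l1 : l < 1 by rewrite ltr_pdivrMr// mul1r ltrD2r.
have tE : t = (1 - l) * x + l * y.
  have : l * (y - x) = t - x by rewrite divfK// gt_eqF.
  lra.
have := FQ x y l a b c; rewrite -tE l0 l1 => /(_ isT a0 b0 c0 ca cb).
set v := (1 - l) * a + l * b => vF.
have v0 : 0 < v by rewrite addr_gt0// mulr_gt0// subr_gt0.
have vt : k * t + h <= v.
  rewrite tE (_ : _ + h = (1 - l) * (k * x + h) + l * (k * y + h)); last by ring.
  by rewrite lerD// ler_wpM2l// ltW// subr_gt0.
split; first by rewrite (lt_le_trans _ vF)// mulr_gt0// exprn_gt0.
rewrite (le_trans _ vF)// ler_pM2l// lerXn2r ?nnegrE ?(ltW v0)//.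
  by rewrite le_max lexx orbT.
by rewrite ge_max vt ltW.
Qed.

Lemma power_concave_nodes m F (k h c lo hi : R) : (0 < m)%N -> 0 < c ->
  power_concave m F -> (forall t, 0 <= F t) -> lo <= hi ->
  (forall t, F t != 0 -> lo <= t -> t <= hi) ->
  exists s1 s2 : R, [/\ lo <= s1, s1 <= s2, s2 <= hi & forall t, lo <= t ->
    (t - s1) * (t - s2) * (F t - c * Num.max (k * t + h) 0 ^+ m) <= 0].
Proof.
move=> m0 c0 FQ F0 lohi Fhi.
(* Positivity of [F] keeps [S] bounded: far out both sides of the last inequality may be 0. *)
pose S := [set t | [/\ lo <= t, 0 < F t & c * Num.max (k * t + h) 0 ^+ m <= F t]].
have [||s1 [s2 [los1 s12 s2hi H]]] := @interval_nodes S lo hi lohi.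
- by move=> t [lot Ft _]; rewrite lot Fhi// gt_eqF.
- move=> x y t [lox Fx cx] [loy Fy cy] /andP[xt ty].
  have xty : x < t < y by rewrite xt.
  have [Ft ct] := power_concave_ge_affine m0 c0 FQ xty Fx Fy cx cy.
  by split=> //; rewrite (le_trans lox)// ltW.
exists s1, s2; split=> // t lot.
apply: (H (fun t => F t - c * Num.max (k * t + h) 0 ^+ m)) => [[_ _ ?]|nS].
  by rewrite subr_ge0.
rewrite subr_le0; have [//|lt] := leP (F t) (c * Num.max (k * t + h) 0 ^+ m).
case: nS; split=> //; last exact: ltW.
by rewrite (le_lt_trans _ lt)// mulr_ge0 ?(ltW c0)// exprn_ge0// le_max lexx orbT.
Qed.

(* the density of a linear image of a simplex all of whose vertices but two
   are sent to [z], the others to [p] and [q] *)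
Definition tent m (p z q C : R) g := [/\
  forall t, t < p -> g t = 0,
  forall t, q < t -> g t = 0,
  p < z -> forall t, p <= t <= z -> g t = C * ((t - p) / (z - p)) ^+ m &
  z < q -> forall t, z <= t <= q -> g t = C * ((q - t) / (q - z)) ^+ m].

(** On the half-line from [z], the sloping part and the zero part of the tent are both given by the
    positive part of the affine function that is 1 at [z] and 0 at [q]. *)
Lemma tent_nodes_right m F g (p z q C L : R) : (0 < m)%N -> 0 < C ->
  power_concave m F -> (forall t, 0 <= F t) ->
  (forall t, F t != 0 -> `|t| <= L) -> tent m p z q C g -> z < q ->
  exists s1 s2 : R, [/\ z <= s1, s1 <= s2 & forall t, z <= t ->
    (t - s1) * (t - s2) * (F t - g t) <= 0].
Proof.
move=> m0 C0 FQ F0 FL [_ gq _ gz] zq.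
have qz0 : q - z != 0 by rewrite subr_eq0 gt_eqF.
have [||s1 [s2 [? ? _ H]]] := @power_concave_nodes m F (- (q - z)^-1)
    (q / (q - z)) C z (Num.max L z) m0 C0 FQ F0.
- by rewrite le_max lexx orbT.
- by move=> t /FL; rewrite ler_norml => /andP[_ tL] _; rewrite le_max tL.
exists s1, s2; split=> // t zt.
suff -> : g t = C * Num.max (- (q - z)^-1 * t + q / (q - z)) 0 ^+ m by exact: H.
have -> : - (q - z)^-1 * t + q / (q - z) = (q - t) / (q - z).
  by rewrite mulrBl mulNr addrC [t / _]mulrC.
have [tq|qt] := leP t q.
  rewrite gz ?zt ?tq// max_l// divr_ge0// subr_ge0//.
  exact: ltW.
rewrite gq// max_r; first by rewrite expr0n gtn_eqF// mulr0.
by rewrite mulr_le0_ge0// ?invr_ge0 ?subr_le0 ?subr_ge0 ltW.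
Qed.

Lemma power_concaveN m F : power_concave m F ->
  power_concave m (fun t => F (- t)).
Proof.
move=> FQ x y l a b c l01 a0 b0 c0 cx cy.
rewrite (_ : - ((1 - l) * x + l * y) = (1 - l) * - x + l * - y); last by ring.
exact: FQ.
Qed.

Lemma tentN m p z q C g : tent m p z q C g ->
  tent m (- q) (- z) (- p) C (fun t => g (- t)).
Proof.
move=> [gp gq gpz gzq]; split.
- by move=> t tq; rewrite gq// ltrNr.
- by move=> t tq; rewrite gp// ltrNl.
- rewrite ltrN2 => zq t /andP[qt tz]; rewrite gzq// 1?lerNr 1?lerNl ?qt ?tz//.
  by rewrite !opprK; congr (_ * (_ / _) ^+ _); ring.
- rewrite ltrN2 => pz t /andP[zt tp]; rewrite gpz// 1?lerNr 1?lerNl ?zt ?tp//.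
  by congr (_ * (_ / _) ^+ _); ring.
Qed.

Lemma tent_nodes_left m F g (p z q C L : R) : (0 < m)%N -> 0 < C ->
  power_concave m F -> (forall t, 0 <= F t) ->
  (forall t, F t != 0 -> `|t| <= L) -> tent m p z q C g -> p < z ->
  exists s1 s2 : R, [/\ s1 <= s2, s2 <= z & forall t, t <= z ->
    (t - s1) * (t - s2) * (F t - g t) <= 0].
Proof.
move=> m0 C0 FQ F0 FL /tentN gN pz.
have [|||s1 [s2 [zs1 s12 H]]] := tent_nodes_right (L := L) m0 C0
    (power_concaveN FQ) _ _ gN => //.
- by move=> t /FL; rewrite normrN.
- by rewrite ltrN2.
exists (- s2), (- s1); split; rewrite ?lerN2//; first by rewrite lerNl.
move=> t tz; have := H (- t); rewrite lerN2 opprK => /(_ tz); congr (_ <= _).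
ring.
Qed.

(** To the left of [z] the tent vanishes, so [F - g = F] is nonnegative there, and [z] becomes the
    third node. *)
Lemma half_tent_nodes m F g (z q C L : R) : (0 < m)%N -> 0 < C -> z < q ->
  power_concave m F -> (forall t, 0 <= F t) ->
  (forall t, F t != 0 -> `|t| <= L) -> tent m z z q C g ->
  exists s1 s2 : R, [/\ z <= s1, s1 <= s2 & forall t,
    (t - z) * ((t - s1) * (t - s2)) * (F t - g t) <= 0].
Proof.
move=> m0 C0 zq FQ F0 FL gt.
have [s1 [s2 [zs1 s12 H]]] := tent_nodes_right m0 C0 FQ F0 FL gt zq.
exists s1, s2; split=> // t; have [zt|tz] := leP z t.
  by rewrite -mulrA mulr_ge0_le0 ?H// subr_ge0.
case: gt => gz _ _ _; rewrite gz// subr0 mulr_le0_ge0// mulr_le0_ge0//.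
  by rewrite subr_le0 ltW.
by rewrite mulr_le0// subr_le0 ltW// (lt_le_trans tz)// (le_trans zs1).
Qed.

Lemma half_tent_pattern m F g (z q C L : R) : (0 < m)%N -> 0 < C -> z < q ->
  power_concave m F -> (forall t, 0 <= F t) ->
  (forall t, F t != 0 -> `|t| <= L) -> tent m z z q C g ->
  exists2 s : seq R, size s = 3 &
    forall t, \prod_(x <- s) (t - x) * (F t - g t) <= 0.
Proof.
move=> m0 C0 zq FQ F0 FL gt.
have [s1 [s2 [_ _ H]]] := half_tent_nodes m0 C0 zq FQ F0 FL gt.
by exists [:: z; s1; s2] => // t; rewrite !big_cons big_nil mulr1.
Qed.

Lemma half_tent_pattern4 m F g (z q C L : R) : (0 < m)%N -> 0 < C -> z < q ->
  power_concave m F -> (forall t, 0 <= F t) ->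
  (forall t, F t != 0 -> `|t| <= L) -> tent m z z q C g ->
  exists2 s : seq R, size s = 4 &
    forall t, \prod_(x <- s) (t - x) * (F t - g t) <= 0.
Proof.
move=> m0 C0 zq FQ F0 FL gt.
have [s1 [s2 [_ _ H]]] := half_tent_nodes m0 C0 zq FQ F0 FL gt.
(* a node to the left of both supports does no harm *)
exists [:: Num.min (- L) z; z; s1; s2] => // t; rewrite !big_cons big_nil mulr1.
rewrite -mulrA; have [mt|tm] := leP (Num.min (- L) z) t.
  by rewrite mulr_ge0_le0 ?subr_ge0// H.
move: tm; rewrite lt_min => /andP[tL tz].
case: gt => -> // _ _ _; have [->|/FL] := eqVneq (F t) 0.
  by rewrite subrr !mulr0.
by rewrite ler_norml leNgt tL.
Qed.

(** For [p < z < q] each side brings its own two nodes, and the pair belonging to one side has a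
    nonnegative product on the other. The case [z = q] is the mirror image of [p = z]. *)
Lemma tent_pattern m F g (p z q C L : R) : (0 < m)%N -> 0 < C ->
  p <= z <= q -> p < q ->
  power_concave m F -> (forall t, 0 <= F t) ->
  (forall t, F t != 0 -> `|t| <= L) -> tent m p z q C g ->
  exists2 s : seq R, size s = 4 &
    forall t, \prod_(x <- s) (t - x) * (F t - g t) <= 0.
Proof.
move=> m0 C0 /andP[]; rewrite le_eqVlt => /orP[/eqP->|pz] zq pq FQ F0 FL gt.
  exact: (half_tent_pattern4 m0 C0 pq FQ F0 FL gt).
move: zq; rewrite le_eqVlt => /orP[/eqP zq|zq].
  move: gt => /tentN; rewrite zq => gt.
  have [|||s szs H] := half_tent_pattern4 (L := L) m0 C0 _
    (power_concaveN FQ) _ _ gt => //.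
  - by rewrite ltrN2.
  - by move=> t /FL; rewrite normrN.
  exists (map -%R s); rewrite ?size_map// => t.
  have := H (- t); rewrite opprK big_map; congr (_ * _ <= _).
  case: s szs {H} => [|a [|b [|c [|d [|]]]]]//= _; rewrite !big_cons !big_nil.
  by ring.
have [r1 [r2 [r12 r2z Hr]]] := tent_nodes_left m0 C0 FQ F0 FL gt pz.
have [s1 [s2 [zs1 s12 Hs]]] := tent_nodes_right m0 C0 FQ F0 FL gt zq.
exists [:: r1; r2; s1; s2] => // t; rewrite !big_cons big_nil mulr1.
have [tz|/ltW zt] := leP t z.
  rewrite (_ : _ * _ = (t - s1) * (t - s2) *
      ((t - r1) * (t - r2) * (F t - g t))); last by ring.
  rewrite mulr_ge0_le0 ?Hr// mulr_le0// subr_le0 (le_trans tz)//.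
  exact: le_trans s12.
rewrite (_ : _ * _ = (t - r1) * (t - r2) *
    ((t - s1) * (t - s2) * (F t - g t))); last by ring.
rewrite mulr_ge0_le0 ?Hs// mulr_ge0// subr_ge0 (le_trans _ zt)//.
exact: le_trans r12 _.
Qed.

(** The higher of two multiples of indicators dominates on its own interval, wherever the other set
    lies, and is zero elsewhere. *)
Lemma interval_indicator_pattern (I J : set R) F g (a b L : R) : a <= b ->
  0 <= a ->
  (forall t, I t -> F t = b) -> (forall t, ~ I t -> F t = 0) ->
  (forall t, J t -> g t = a) -> (forall t, ~ J t -> g t = 0) ->
  (forall x y t, I x -> I y -> x < t < y -> I t) ->
  (forall t, I t -> `|t| <= L) ->
  exists2 s : seq R, size s = 2 &
    forall t, \prod_(x <- s) (t - x) * (F t - g t) <= 0.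
Proof.
move=> ab a0 FI FnI gJ gnJ Ic IL.
have [||s1 [s2 [_ _ _ H]]] := @interval_nodes I (- `|L|) `|L| _ _ Ic.
- by rewrite lerNl (le_trans (_ : _ <= 0)) ?oppr_le0.
- by move=> t /IL tL; rewrite -ler_norml (le_trans tL)// ler_norm.
exists [:: s1; s2] => // t; rewrite !big_cons big_nil mulr1.
have gab : 0 <= g t <= a.
  by have [/gJ->|/gnJ->] := pselect (J t); rewrite lexx a0.
apply: (H (fun t => F t - g t)) => [/FI->|/FnI->].
  by rewrite subr_ge0 (le_trans _ ab)//; case/andP: gab.
by rewrite sub0r oppr_le0; case/andP: gab.
Qed.

End tents.

(** * Lebesgue measure on row vectors *)

Section lebesgue_rV_theory.
Context {R : realType}.
Local Notation leb := (@lebesgue_measure R).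
Local Open Scope ereal_scope.

Definition box n (A : 'I_n -> set R) : set 'rV[R]_n :=
  [set x | forall i, A i (x ord0 i)].

Lemma measurable_box n (A : 'I_n -> set R) :
  (forall i, measurable (A i)) -> measurable (box A).
Proof.
move=> mA; rewrite (_ : box A = ~` \big[setU/set0]_(i < n)
    ((fun x : 'rV[R]_n => x ord0 i) @^-1` ~` A i)).
  apply: measurableC; apply: bigsetU_measurable => i _.
  rewrite -[X in measurable X]setTI; apply: measurable_coord => //.
  exact: measurableC.
apply/seteqP; split=> x /=; rewrite -bigcup_seq.
  by move=> Ax [i _]; apply; exact: Ax.
move=> nAx i; apply: contrapT => nAi; apply: nAx; exists i => //=.
exact: mem_index_enum.
Qed.

Lemma lebesgue_boxE n (A : 'I_n -> set R) : (forall i, measurable (A i)) ->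
  lebesgue_rV R n (box A) = \prod_(i < n) leb (A i).
Proof. exact: lebesgue_rV_box. Qed.

Let boxes n : set (set 'rV[R]_n) :=
  [set B | exists2 A : 'I_n -> set R, (forall i, measurable (A i)) & B = box A].

Let measurable_rVE n : (measurable : set (set 'rV[R]_n)) = <<s @boxes n >>.
Proof.
rewrite eqEsubset; split.
  apply: smallest_sub; first exact: smallest_sigma_algebra.
  case: n => [|n]; first by rewrite big_ord0.
  rewrite -bigcup_mkord_ord; apply: bigcup_sub => i _ _ [B mB <-].
  apply: sub_sigma_algebra.
  exists (fun k => if k == inord i then B else setT).
    by move=> k; case: ifP.
  apply/seteqP; split=> x /=.
    by move=> [_ xB] k; case: ifPn => [/eqP->|].
  by move=> /(_ (inord i)); rewrite eqxx.
apply: smallest_sub; first exact: sigma_algebra_measurable.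
by move=> _ [A mA ->]; exact: measurable_box.
Qed.

Lemma lebesgue_rV_unique n (mu : {measure set 'rV[R]_n -> \bar R}) :
  (forall A : 'I_n -> set R, (forall i, measurable (A i)) ->
    mu (box A) = \prod_(i < n) leb (A i)) ->
  forall E, measurable E -> lebesgue_rV R n E = mu E.
Proof.
move=> muE E mE.
pose J (k : nat) : set R := `](- k%:R)%R, k%:R[%classic.
apply: (@measure_unique _ _ _ (@boxes n) (fun k => box (fun=> J k))) => //.
- exact: measurable_rVE.
- move=> _ _ [A mA ->] [B mB ->]; exists (fun i => A i `&` B i).
    by move=> i; exact: measurableI.
  by apply/seteqP; split=> [x [xA xB] i|x AB]//; split=> i; have [] := AB i.
- by move=> k; exists (fun=> J k) => // i; exact: measurable_itv.
- apply/seteqP; split=> // x _.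
  have [M xM] : exists M : nat, forall i, (`|x ord0 i| < M%:R)%R.
    exists (\max_i (Num.bound `|x ord0 i|%R)) => i.
    apply: (lt_le_trans (archi_boundP (normr_ge0 _))).
    by rewrite ler_nat (@leq_bigmax _ (fun i => Num.bound `|x ord0 i|%R)).
  by exists M => // i; rewrite /J/= in_itv/= -ltr_norml.
- by move=> _ [A mA ->]; rewrite muE//; exact: lebesgue_boxE.
- move=> k; rewrite [X in X < _](lebesgue_boxE (A := fun=> J k)); last first.
    by move=> i; exact: measurable_itv.
  rewrite ltey_eq prode_fin_num// => i _.
  by rewrite lebesgue_measure_itv/=; case: ifP.
Qed.


(** Reduces a change of variables to boxes, where it becomes a product of one-dimensional
    statements. *)
Lemma lebesgue_rV_pushforward n d (T : measurableType d)
    (mu : {measure set T -> \bar R}) (phi : T -> 'rV[R]_n) (c : R) :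
  measurable_fun setT phi -> (0 <= c)%R ->
  (forall A : 'I_n -> set R, (forall i, measurable (A i)) ->
    c%:E * mu (phi @^-1` box A) = \prod_(i < n) leb (A i)) ->
  forall E, measurable E -> lebesgue_rV R n E = c%:E * mu (phi @^-1` E).
Proof.
move=> mphi c0 H E mE.
pose nu := mscale (NngNum c0) (pushforward mu phi).
by rewrite (@lebesgue_rV_unique _ (nu mphi)).
Qed.

Lemma lebesgue_measure_affine (a b : R) (A : set R) : a != 0%R ->
  measurable A ->
  leb ((fun x => a * x + b)%R @^-1` A) = `|a|^-1%:E * leb A.
Proof.
move=> a0 mA.
pose phi : measurableTypeR R -> measurableTypeR R := fun x => (a * x + b)%R.
have mphi : measurable_fun setT phi.
  by apply: measurable_funD => //; exact: measurable_funM.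
have c0 : (0 <= `|a|)%R by [].
pose nu := mscale (NngNum c0) (pushforward leb phi).
rewrite [in RHS](@lebesgue_measure_unique _ (nu mphi))//; last first.
  move=> _ [[x y] _ <-] /=; rewrite /nu /mscale /= /pushforward /phi.
  have [a_lt0|a_gt0|a00] := ltgtP a 0%R; last by rewrite a00 eqxx in a0.
    rewrite (_ : _ @^-1` _ = `[((y - b) / a)%R, ((x - b) / a)%R[%classic); last first.
      apply/seteqP; split=> t /=; rewrite !in_itv/=.
        move=> /andP[h1 h2]; apply/andP; split.
          by rewrite ler_ndivrMr//; lra.
        by rewrite ltr_ndivlMr//; lra.
      rewrite ler_ndivrMr// ltr_ndivlMr// => /andP[h1 h2].
      by apply/andP; split; lra.
    rewrite !lebesgue_measure_itv/= !lte_fin ltr_nM2r ?invr_lt0// ltrD2r.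
    case: ifPn => xy; last by rewrite mule0.
    rewrite -!EFinB -EFinM ltr0_norm//; congr EFin.
    by field.
  rewrite (_ : _ @^-1` _ = `]((x - b) / a)%R, ((y - b) / a)%R]%classic); last first.
    apply/seteqP; split=> t /=; rewrite !in_itv/=.
      move=> /andP[h1 h2]; apply/andP; split.
        by rewrite ltr_pdivrMr//; lra.
      by rewrite ler_pdivlMr//; lra.
    rewrite ltr_pdivrMr// ler_pdivlMr// => /andP[h1 h2].
    by apply/andP; split; lra.
  rewrite !lebesgue_measure_itv/= !lte_fin ltr_pM2r ?invr_gt0// ltrD2r.
  case: ifPn => xy; last by rewrite mule0.
  rewrite -!EFinB -EFinM gtr0_norm//; congr EFin.
  by field.
by rewrite /nu /mscale /= muleA -EFinM mulVf ?normr_eq0// mul1e.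
Qed.

Lemma ge0_integral_affine (a b : R) (f : R -> \bar R) : a != 0%R ->
  measurable_fun [set: R] f -> (forall x, 0 <= f x) ->
  \int[leb]_x f (a * x + b)%R = `|a|^-1%:E * \int[leb]_x f x.
Proof.
move=> a0 mf f0.
pose phi : measurableTypeR R -> measurableTypeR R := fun x => (a * x + b)%R.
have mphi : measurable_fun setT phi.
  by apply: measurable_funD => //; exact: measurable_funM.
have c0 : (0 <= `|a|^-1)%R by rewrite invr_ge0.
rewrite -[LHS](@ge0_integral_pushforward _ _ _ _ _ _ mphi leb setT f)//.
transitivity (\int[mscale (NngNum c0) leb]_x f x); last first.
  by rewrite ge0_integral_mscale.
apply: eq_measure_integral => A mA _.
exact: lebesgue_measure_affine.
Qed.

Lemma measurable_affine_rV n (r : R) (u : 'rV[R]_n) :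
  measurable_fun [set: 'rV[R]_n] (fun w : 'rV[R]_n => r *: w + u)%R.
Proof.
apply/measurable_fun_coordP => i; under eq_fun do rewrite !mxE.
apply: measurable_funD => //; apply: measurable_funM => //.
exact: measurable_coord.
Qed.

Lemma lebesgue_rV_homothety n (r : R) (u : 'rV[R]_n) (A : set 'rV[R]_n) :
  (0 < r)%R -> measurable A ->
  lebesgue_rV R n A =
  (r ^+ n)%:E * lebesgue_rV R n ((fun w => r *: w + u)%R @^-1` A).
Proof.
move=> r0; apply: lebesgue_rV_pushforward.
- exact: measurable_affine_rV.
- by rewrite exprn_ge0// ltW.
- move=> B mB.
  pose C i : set R := (fun x => r * x + u ord0 i)%R @^-1` B i.
  have mC i : measurable (C i).
    rewrite -[C i]setTI; apply: (_ : measurable_fun _ _) => //.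
    by apply: measurable_funD => //; exact: measurable_funM.
  rewrite (_ : _ @^-1` _ = box C); last first.
    by apply/seteqP; split=> w /= H i; have := H i; rewrite !mxE.
  rewrite [X in _ * X = _](lebesgue_boxE mC).
  transitivity ((r ^+ n)%:E * \prod_(i < n) ((r^-1)%:E * leb (B i))).
    congr (_ * _); apply: eq_bigr => i _.
    by rewrite lebesgue_measure_affine ?gt_eqF// gtr0_norm.
  rewrite big_split/= prodEFin prodr_const card_ord muleA -EFinM -exprMn.
  by rewrite divff ?gt_eqF// expr1n mul1e.
Qed.

(** An arbitrary position [i] is allowed because the equation of a hyperplane can be solved only for
    a coordinate with nonzero coefficient. *)
Definition insertV m (i : 'I_m.+1) (p : R * 'rV[R]_m) : 'rV[R]_m.+1 :=
  \row_j (if unlift i j is Some k then p.2 ord0 k else p.1).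

Lemma insertV_diag m (i : 'I_m.+1) p : insertV i p ord0 i = p.1.
Proof. by rewrite mxE unlift_none. Qed.

Lemma insertV_lift m (i : 'I_m.+1) p k : insertV i p ord0 (lift i k) = p.2 ord0 k.
Proof. by rewrite mxE liftK. Qed.

Lemma measurable_insertV m (i : 'I_m.+1) :
  measurable_fun [set: R * 'rV[R]_m] (insertV i).
Proof.
apply/measurable_fun_coordP => j; under eq_fun do rewrite mxE.
case: unliftP => [k _|_]; last exact: measurable_fst.
exact: (measurableT_comp (@measurable_coord R m k) measurable_snd).
Qed.

Lemma lebesgue_rV_insert m (i : 'I_m.+1) (A : set 'rV[R]_m.+1) :
  measurable A ->
  lebesgue_rV R m.+1 A = (leb \x lebesgue_rV R m) (insertV i @^-1` A).
Proof.
move=> mA; rewrite -[RHS]mul1e.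
apply: lebesgue_rV_pushforward => //; first exact: measurable_insertV.
move=> B mB; rewrite mul1e.
rewrite (_ : _ @^-1` _ = B i `*` box (fun k => B (lift i k))); last first.
  apply/seteqP; split=> [[a v]/= H|[a v]/= [Ha Hv] j].
    split=> [|k]; first by have := H i; rewrite insertV_diag.
    by have := H (lift i k); rewrite insertV_lift.
  by rewrite mxE; case: unliftP => [k ->|->] //; exact: Hv.
rewrite (bigD1_ord i)//=.
rewrite -(lebesgue_boxE (A := fun k => B (lift i k)))//.
apply: product_measure1E; first exact: mB.
by apply: (measurable_box (A := fun k => B (lift i k))) => k; exact: mB.
Qed.

Lemma measurable_ball_rV n (x : 'rV[R]_n) (e : R) : (0 < e)%R ->
  measurable (ball x e).
Proof.
move=> e0; rewrite (_ : ball x e = box (fun i => ball (x ord0 i) e)).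
  by apply: measurable_box => i; exact: measurable_ball.
apply/seteqP; split=> [y [_ xy] i|y xy]; first exact: xy.
by split=> // i j; rewrite (ord1 i); exact: xy.
Qed.

(** The sigma-algebra is generated by coordinates, so topology has to be turned into boxes: [K] is
    the intersection over [k] of finite unions of sup-norm balls of radius [1 / k.+1], and these
    balls are boxes. *)
Lemma compact_measurable_rV n (K : set 'rV[R]_n) : compact K -> measurable K.
Proof.
move=> cK.
have clK : closed K by apply: compact_closed => //; exact: norm_hausdorff.
have e0 k : (0 < k.+1%:R^-1 :> R)%R by rewrite invr_gt0.
have cov k : exists D : set 'rV[R]_n, [/\ finite_set D, D `<=` K &
    K `<=` \bigcup_(x in D) ball x k.+1%:R^-1].
  move: cK; rewrite compact_cover => /(_ _ K (fun x => (ball x k.+1%:R^-1)^°)).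
  case.
  - by move=> x _; exact: open_interior.
  - move=> x Kx; exists x => //; rewrite /interior; apply: nbhsx_ballx.
    exact: e0.
  - move=> D DK KD; exists [set` D]; split; first exact: finite_fset.
      by move=> x /DK /set_mem.
    apply: subset_trans KD _.
    by apply: subset_bigcup => x _; exact: interior_subset.
have [D DP] := choice cov.
rewrite (_ : K = \bigcap_k \bigcup_(x in D k) ball x k.+1%:R^-1).
  apply: bigcapT_measurable => k; apply: fin_bigcup_measurable => [|x _].
    by have [] := DP k.
  exact: measurable_ball_rV.
apply/seteqP; split=> [x Kx k _|x Hx]; first by have [_ _] := DP k; exact.
apply: clK => B /nbhs_ballP [e /= e_gt0 eB].
near \oo => k.
have [y Dy xy] := Hx k I; exists y; split.
  by have [_ + _] := DP k; exact.
apply: eB; apply: ball_sym; apply: le_ball xy.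
by apply: ltW; near: k; exact: near_infty_natSinv_lt (PosNum e_gt0).
Unshelve. all: by end_near. Qed.

Definition cube n (L : R) : set 'rV[R]_n :=
  [set x | forall i, `|x ord0 i| <= L]%R.
Arguments cube : clear implicits.

Lemma cubeE n L : cube n L = box (fun=> `[(- L)%R, L]%classic).
Proof.
by apply/seteqP; split=> x xL i; have := xL i; rewrite /= in_itv/= ler_norml.
Qed.

Lemma measurable_cube n L : measurable (cube n L).
Proof. by rewrite cubeE; apply: measurable_box. Qed.

Lemma lebesgue_cube_fin n L (A : set 'rV[R]_n) : measurable A ->
  A `<=` cube n L -> lebesgue_rV R n A \is a fin_num.
Proof.
move=> mA AL; rewrite ge0_fin_numE//.
apply: (@le_lt_trans _ _ (lebesgue_rV R n (cube n L))).
  by apply: le_measure => //; apply: mem_set => //; exact: measurable_cube.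
rewrite cubeE lebesgue_boxE// ltey_eq prode_fin_num// => i _.
by rewrite lebesgue_measure_itv/=; case: ifP.
Qed.

Lemma compact_cube n (K : set 'rV[R]_n) : compact K -> exists L, K `<=` cube n L.
Proof.
move=> /compact_bounded [M [_ KM]]; exists (M + 1)%R => x Kx i.
apply: le_trans (KM (M + 1)%R _ x Kx); last by rewrite ltrDl.
rewrite [leRHS]/Num.Def.normr/= mx_normrE.
by apply/bigmax_geP; right; exists (ord0, i).
Qed.

End lebesgue_rV_theory.

Arguments cube {R} n L _.

(** * The Brunn-Minkowski inequality for convex sets *)

Section borell_brascamp_lieb.
Context {R : realType}.
Local Notation leb := (@lebesgue_measure R).
Implicit Types (f F : R -> R) (I J S : set R).

(** Convexity of the power function: the left side is its tangent at [r]. *)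
Lemma expr_tangent m (t r : R) : 0 <= t -> 0 <= r ->
  m.+1%:R * r ^+ m * t - m%:R * r ^+ m.+1 <= t ^+ m.+1.
Proof.
move=> t0 r0; elim: m => [|m IH]; first by rewrite expr0 !expr1; lra.
rewrite [leRHS]exprS (le_trans _ (ler_wpM2l t0 IH))// -subr_ge0.
rewrite (_ : _ - _ = r ^+ m * m.+1%:R * (t - r) ^+ 2).
  by rewrite mulr_ge0 ?sqr_ge0// mulr_ge0 ?exprn_ge0.
by rewrite !exprS -!natr1; ring.
Qed.

(** The perspective [u ^+ m.+1 / v ^+ m] is jointly convex: scaling the tangent of the power at [r]
    by [v] gives a minorant linear in [(u, v)]. The slope point [r = A / Z] makes it exact at the
    convex combination. *)
Lemma radon_ineq m (l a b x y : R) : 0 < l < 1 -> 0 < a -> 0 < b ->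
  0 < x -> 0 < y ->
  ((1 - l) * a + l * b) ^+ m.+1 <= ((1 - l) * x + l * y) ^+ m *
    ((1 - l) * (a ^+ m.+1 / x ^+ m) + l * (b ^+ m.+1 / y ^+ m)).
Proof.
move=> /andP[l0 l1] a0 b0 x0 y0; have l10 : 0 < 1 - l by rewrite subr_gt0.
set A := _ + l * b; set Z := _ + l * y.
have A0 : 0 < A by rewrite addr_gt0// mulr_gt0.
have Z0 : 0 < Z by rewrite addr_gt0// mulr_gt0.
pose r := A / Z; have r0 : 0 < r by rewrite divr_gt0.
have tangent (u v : R) : 0 < u -> 0 < v ->
    m.+1%:R * r ^+ m * u - m%:R * r ^+ m.+1 * v <= u ^+ m.+1 / v ^+ m.
  move=> u0 v0; rewrite (_ : u ^+ _ / _ = v * (u / v) ^+ m.+1); last first.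
    by rewrite expr_div_n exprS [v ^+ m.+1]exprS; field; rewrite expf_neq0 ?gt_eqF.
  have := @expr_tangent m (u / v) r (ltW (divr_gt0 u0 v0)) (ltW r0).
  move=> /(ler_wpM2l (ltW v0)); apply: le_trans.
  by rewrite le_eqVlt; apply/orP; left; apply/eqP; field; rewrite gt_eqF.
apply: (@le_trans _ _ (Z ^+ m * (m.+1%:R * r ^+ m * A - m%:R * r ^+ m.+1 * Z))).
  rewrite /r !exprS !expr_div_n -natr1.
  rewrite le_eqVlt; apply/orP; left; apply/eqP; field.
  by rewrite expf_neq0 ?gt_eqF.
rewrite ler_wpM2l ?exprn_ge0 ?(ltW Z0)//.
have := lerD (ler_wpM2l (ltW l10) (tangent _ _ a0 x0))
  (ler_wpM2l (ltW l0) (tangent _ _ b0 y0)).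
apply: le_trans; rewrite /A /Z; lra.
Qed.

(** Brunn-Minkowski on the line: [S] contains the open interval between the combined infima and the
    combined suprema, and its length already bounds the left side. *)
Lemma interval_sum_length I J S (l L : R) : 0 < l < 1 ->
  I !=set0 -> J !=set0 -> measurable I -> measurable J -> measurable S ->
  (forall x y t, I x -> I y -> x <= t <= y -> I t) ->
  (forall x y t, J x -> J y -> x <= t <= y -> J t) ->
  (forall t, I t -> `|t| <= L) -> (forall t, J t -> `|t| <= L) ->
  (forall x y, I x -> J y -> S ((1 - l) * x + l * y)) ->
  ((1 - l)%:E * leb I + l%:E * leb J <= leb S)%E.
Proof.
move=> /andP[l0 l1] I0 J0 mI mJ mS Ic Jc IL JL IJS.
have l10 : 0 < 1 - l by rewrite subr_gt0.
have bounded_len (A : set R) : A !=set0 -> measurable A ->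
    (forall t, A t -> `|t| <= L) ->
    [/\ has_inf A, has_sup A, inf A <= sup A &
        (leb A <= (sup A - inf A)%:E)%E].
  move=> A0 mA AL.
  have iA : has_inf A.
    by split=> //; exists (- L) => t /AL; rewrite ler_norml => /andP[].
  have sA : has_sup A.
    by split=> //; exists L => t /AL; rewrite ler_norml => /andP[].
  have isA : inf A <= sup A.
    by case: (A0) => t At; exact: le_trans (ge_inf iA.2 At) (ub_le_sup sA.2 At).
  split=> //.
  apply: (@le_trans _ _ (leb `[inf A, sup A]%classic)).
    apply: le_measure => //; first exact: mem_set.
      by apply: mem_set => //; exact: measurable_itv.
    move=> t At /=; rewrite in_itv/= (ge_inf iA.2 At)/=.
    exact: (ub_le_sup sA.2 At).
  rewrite lebesgue_measure_itv/= lte_fin; case: ifPn => _; first by [].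
  by rewrite lee_fin subr_ge0.
have [iI sI isI lenI] := bounded_len I I0 mI IL.
have [iJ sJ isJ lenJ] := bounded_len J J0 mJ JL.
pose u := (1 - l) * inf I + l * inf J; pose v := (1 - l) * sup I + l * sup J.
apply: (@le_trans _ _ (v - u)%:E).
  rewrite (_ : v - u = (1 - l) * (sup I - inf I) + l * (sup J - inf J)); last first.
    by rewrite /u /v; ring.
  rewrite [X in (_ <= X)%E]EFinD; apply: leeD.
    by rewrite [X in (_ <= X)%E]EFinM lee_wpmul2l// lee_fin ltW.
  by rewrite [X in (_ <= X)%E]EFinM lee_wpmul2l// lee_fin ltW.
apply: (@le_trans _ _ (leb `]u, v[%classic)).
  rewrite lebesgue_measure_itv/= lte_fin; case: ifPn => uv; first by [].
  by rewrite lee_fin subr_le0 leNgt.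
apply: le_measure; [|exact: mem_set|].
  by apply: mem_set; exact: measurable_itv.
move=> t /=; rewrite in_itv/= => /andP[ut tv].
have vt0 : 0 < v - t by rewrite subr_gt0.
have tu0 : 0 < t - u by rewrite subr_gt0.
have [x1 Ix1 hx1] := sup_adherent vt0 sI.
have [y1 Jy1 hy1] := sup_adherent vt0 sJ.
have [x0 Ix0 hx0] := inf_adherent tu0 iI.
have [y0 Jy0 hy0] := inf_adherent tu0 iJ.
pose t0 := (1 - l) * x0 + l * y0; pose t1 := (1 - l) * x1 + l * y1.
have t0t : t0 < t.
  have : (1 - l) * x0 + l * y0 < (1 - l) * (inf I + (t - u)) + l * (inf J + (t - u)).
    by rewrite ltrD// ltr_pM2l.
  by rewrite /t0 /u; lra.
have tt1 : t < t1.
  have : (1 - l) * (sup I - (v - t)) + l * (sup J - (v - t)) < (1 - l) * x1 + l * y1.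
    by rewrite ltrD// ltr_pM2l.
  by rewrite /t1 /v; lra.
(* The same [tau] is used in [I] and in [J]; exchanging the two convex combinations then exhibits
   [t] as an element of [S]. *)
pose tau := (t - t0) / (t1 - t0).
have t10 : 0 < t1 - t0 by rewrite subr_gt0; exact: lt_trans tt1.
have tau0 : 0 <= tau by apply: divr_ge0; apply: ltW => //; rewrite subr_gt0.
have tau1 : tau <= 1 by rewrite ler_pdivrMr// mul1r lerD2r ltW.
have tE : t = (1 - tau) * t0 + tau * t1.
  have : tau * (t1 - t0) = t - t0 by rewrite divfK// gt_eqF.
  lra.
have conv (A : set R) x y : (forall x y t, A x -> A y -> x <= t <= y -> A t) ->
    A x -> A y -> A ((1 - tau) * x + tau * y).
  move=> Ac Ax Ay; have [xy|/ltW yx] := leP x y.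
    by apply: (Ac x y) => //; apply/andP; split; nra.
  by apply: (Ac y x) => //; apply/andP; split; nra.
have := IJS _ _ (conv _ _ _ Ic Ix0 Ix1) (conv _ _ _ Jc Jy0 Jy1).
by congr S; rewrite tE /t0 /t1; ring.
Qed.

(** The value 0 at negative levels turns the layer-cake integral over the positive half-line into
    one over the whole line. *)
Definition tail f (r : R) : \bar R :=
  if 0 <= r then leb [set x | r < f x] else 0.

(** Tonelli on the region [H] under the graph, whose vertical sections are [[0, f x[] and whose
    horizontal ones are the level sets. *)
Lemma layer_cake f : measurable_fun setT f -> (forall x, 0 <= f x) ->
  measurable_fun setT (tail f) /\
  (\int[leb]_x (f x)%:E = \int[leb]_r tail f r)%E.
Proof.
move=> mf f0.
pose H : set (R * R) := [set p | 0 <= p.2 /\ p.2 < f p.1].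
have mH : measurable H.
  have -> : H = setT `&` (fun p => (0 <= p.2) && (p.2 < f p.1)) @^-1` [set true].
    by rewrite setTI; apply/seteqP; split=> p /= => [[-> ->]//|/andP].
  apply: (_ : measurable_fun setT _) => //; apply: measurable_and.
    apply: measurable_fun_ler => //; exact: measurable_snd.
  apply: measurable_fun_ltr; first exact: measurable_snd.
  by apply: measurableT_comp => //; exact: measurable_fst.
have yE r : leb (ysection H r) = tail f r.
  rewrite /tail ysectionE; case: ifPn => r0.
    by congr (leb _); apply/seteqP; split=> [x []|x xr]//; split.
  rewrite (_ : _ @^-1` _ = set0) ?measure0//; apply/seteqP; split=> x //=.
  by rewrite /H/= (negbTE r0) => -[].
have xE x : leb (xsection H x) = (f x)%:E.
  rewrite (_ : xsection H x = `[0, f x[%classic).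
    rewrite lebesgue_measure_itv/= lte_fin; case: ifPn; first by rewrite oppr0 adde0.
    by rewrite -leNgt => fx0; congr EFin; apply/eqP; rewrite eq_le f0 fx0.
  rewrite xsectionE; apply/seteqP; split=> r /=; rewrite in_itv /H/=.
    by move=> [-> ->].
  by move/andP.
have <- : leb \o ysection H = tail f by apply/funext => r /=; exact: yE.
split; first exact: measurable_fun_ysection.
under eq_integral do rewrite -xE.
have := indic_fubini_tonelli leb leb mH.
by rewrite indic_fubini_tonelli_FE// indic_fubini_tonelli_GE.
Qed.

End borell_brascamp_lieb.

(** * An integral inequality on the line from lengths of level sets *)

Section borell_brascamp_lieb_line.
Context {R : realType}.
Local Notation leb := (@lebesgue_measure R).
Implicit Types (f alpha beta gamma : R -> R).

Lemma tail_ge0 f r : (0 <= tail f r)%E.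
Proof. by rewrite /tail; case: ifP. Qed.

Lemma integral_tail_scale f (U : R) : measurable_fun setT f ->
  (forall x, 0 <= f x) -> 0 < U ->
  measurable_fun setT (fun s => tail f (U * s)) /\
  (\int[leb]_x (f x)%:E = U%:E * \int[leb]_s tail f (U * s)%R)%E.
Proof.
move=> mf f0 U0; have [mt ->] := layer_cake mf f0.
split.
  by apply: measurableT_comp mt _; exact: measurable_funM.
have := @ge0_integral_affine R U 0 (tail f); rewrite gt_eqF// => /(_ isT mt).
move=> /(_ (@tail_ge0 f)); under eq_integral do rewrite addr0.
by move=> ->; rewrite muleA -EFinM gtr0_norm// divff ?gt_eqF// mul1e.
Qed.

(** The supremum of [f] is written as [a ^+ m]. For [m = 0] it must therefore be 1, which is why [f]
    then has to be 0-1 valued. *)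
Lemma sup_is_power m f (B : R) : (forall x, 0 <= f x) -> (forall x, f x <= B) ->
  (m = 0%N -> forall x, f x = 0 \/ f x = 1) ->
  (0 < \int[leb]_x (f x)%:E)%E ->
  exists2 a, 0 < a & (forall x, f x <= a ^+ m) /\
    forall r, r < a ^+ m -> exists x, r < f x.
Proof.
move=> f0 fB f01 If.
have [x0 fx0] : exists x, 0 < f x.
  apply: contrapT => /forallNP fle; move: If; rewrite integral0_eq ?ltxx// => x _.
  by congr EFin; apply/eqP; rewrite eq_le f0 andbT leNgt; apply/negP/fle.
have ubf : has_sup (range f).
  by split; [exists (f x0), x0|exists B => _ [x _ <-]].
pose U := sup (range f).
have fU x : f x <= U by apply: ub_le_sup; [exact: ubf.2|exists x].
have U0 : 0 < U by apply: lt_le_trans (fU x0).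
have Uf r : r < U -> exists x, r < f x.
  by move=> /(sup_gt ubf.1) [_ [x _ <-]]; exists x.
suff [a a0 aU] : exists2 a, 0 < a & a ^+ m = U.
  by exists a => //; rewrite aU.
case: m f01 => [/(_ erefl) f01|m _].
  exists 1 => //; rewrite expr0; apply/eqP; rewrite eq_le; apply/andP; split.
    by have [fx00|<-//] := f01 x0; rewrite fx00 ltxx in fx0.
  by apply: sup_le_ub; [exists (f x0), x0|move=> _ [x _ <-]; case: (f01 x) => ->].
exists (U `^ (m.+1%:R^-1)); first exact: powR_gt0.
by rewrite -powR_mulrn ?powR_ge0// -powRrM mulVf ?pnatr_eq0// powRr1// ltW.
Qed.

(** The inductive step of Brunn-Minkowski, with the functions in the role of slice volumes. Levels
    of [alpha] and [beta] are measured relative to their suprema, so that for [0 <= s < 1] both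
    level sets are nonempty intervals. Integrating the inequality between their lengths over [s]
    leaves a numerical inequality, which is Radon's. *)
Lemma bbl_line m alpha beta gamma (l L B : R) : 0 < l < 1 ->
  measurable_fun setT alpha -> measurable_fun setT beta ->
  measurable_fun setT gamma -> (forall x, 0 <= alpha x) ->
  (forall x, 0 <= beta x) -> (forall x, 0 <= gamma x) ->
  (forall x, alpha x <= B) -> (forall x, beta x <= B) ->
  (forall x, alpha x != 0 -> `|x| <= L) ->
  (forall x, beta x != 0 -> `|x| <= L) ->
  (forall r x y t, 0 <= r -> r < alpha x -> r < alpha y -> x <= t <= y ->
    r < alpha t) ->
  (forall r x y t, 0 <= r -> r < beta x -> r < beta y -> x <= t <= y ->
    r < beta t) ->
  (m = 0%N -> forall x, alpha x = 0 \/ alpha x = 1) ->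
  (m = 0%N -> forall x, beta x = 0 \/ beta x = 1) ->
  (forall x y a b c, 0 < a -> 0 < b -> 0 < c ->
    c * a ^+ m <= alpha x -> c * b ^+ m <= beta y ->
    c * ((1 - l) * a + l * b) ^+ m <= gamma ((1 - l) * x + l * y)) ->
  forall a b c, 0 < a -> 0 < b -> 0 < c ->
    ((c * a ^+ m.+1)%:E <= \int[leb]_x (alpha x)%:E)%E ->
    ((c * b ^+ m.+1)%:E <= \int[leb]_x (beta x)%:E)%E ->
    ((c * ((1 - l) * a + l * b) ^+ m.+1)%:E <= \int[leb]_x (gamma x)%:E)%E.
Proof.
move=> l01 ma mb mg a0 b0 g0 aB bB aL bL ac bc a01 b01 abg a b c a_gt0 b_gt0 c_gt0.
have /andP[l0 l1] := l01; have l10 : 0 < 1 - l by rewrite subr_gt0.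
move=> Ia Ib.
have [|x x0 [aU Ua]] := sup_is_power a0 aB a01.
  by apply: lt_le_trans Ia; rewrite lte_fin mulr_gt0// exprn_gt0.
have [|y y0 [bV Vb]] := sup_is_power b0 bB b01.
  by apply: lt_le_trans Ib; rewrite lte_fin mulr_gt0// exprn_gt0.
pose U := x ^+ m; pose V := y ^+ m; pose M := ((1 - l) * x + l * y) ^+ m.
have U0 : 0 < U by rewrite exprn_gt0.
have V0 : 0 < V by rewrite exprn_gt0.
have M0 : 0 < M by rewrite exprn_gt0// addr_gt0// mulr_gt0.
have level s : ((1 - l)%:E * tail alpha (U * s)%R + l%:E * tail beta (V * s)%R
    <= tail gamma (M * s)%R)%E.
  have [s0|s0] := ltP s 0.
    by rewrite /tail !pmulr_rge0// (lt_geF s0) !mule0 adde0.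
  rewrite /tail !pmulr_rge0// s0.
  have [s1|s1] := leP 1 s.
    rewrite [X in (_ * leb X + _)%E](_ : _ = set0); last first.
      apply/seteqP; split=> t //=; rewrite ltNge (le_trans (aU t))//.
      by rewrite ler_peMr// ltW.
    rewrite [X in (_ + _ * leb X)%E](_ : _ = set0); last first.
      apply/seteqP; split=> t //=; rewrite ltNge (le_trans (bV t))//.
      by rewrite ler_peMr// ltW.
    by rewrite measure0 !mule0 adde0.
  have mlevel f (r : R) : measurable_fun setT f -> measurable [set t | r < f t].
    move=> mf; rewrite -[X in measurable X]setTI.
    rewrite (_ : [set t | r < f t] = (fun t => r < f t) @^-1` [set true])//.
    by apply: (_ : measurable_fun _ _) => //; exact: measurable_fun_ltr.
  have Us0 : 0 <= U * s by rewrite mulr_ge0// ltW.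
  have Vs0 : 0 <= V * s by rewrite mulr_ge0// ltW.
  apply: (@interval_sum_length _ _ _ _ l L) => //; try exact: mlevel.
  - by apply: Ua; rewrite gtr_pMr.
  - by apply: Vb; rewrite gtr_pMr.
  - by move=> u v t; exact: ac.
  - by move=> u v t; exact: bc.
  - by move=> t /= /(le_lt_trans Us0) /lt0r_neq0; exact: aL.
  - by move=> t /= /(le_lt_trans Vs0) /lt0r_neq0; exact: bL.
  - move=> u v /= su sv.
    (* Both points lie above relative level [s], hence at relative level at least [k > s]; [k] is
       the common factor fed to the hypothesis on [gamma]. *)
    pose k := Num.min (alpha u / U) (beta v / V).
    have sk : s < k by rewrite lt_min !ltr_pdivlMr// mulrC su mulrC sv.
    have k0 : 0 < k by exact: le_lt_trans sk.
    apply: (@lt_le_trans _ _ (k * M)); first by rewrite mulrC ltr_pM2r.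
    by apply: abg => //; rewrite -ler_pdivlMr// ge_min lexx ?orbT.
have [mta IaE] := integral_tail_scale ma a0 U0.
have [mtb IbE] := integral_tail_scale mb b0 V0.
have [mtg ->] := integral_tail_scale mg g0 M0.
apply: (@le_trans _ _ (M%:E *
    ((1 - l)%:E * \int[leb]_s tail alpha (U * s)%R +
     l%:E * \int[leb]_s tail beta (V * s)%R))%E); last first.
  rewrite lee_wpmul2l// ?lee_fin ?(ltW M0)//.
  rewrite -!ge0_integralZl_EFin ?(ltW l0) ?(ltW l10)//;
    [|by move=> *; exact: tail_ge0..].
  rewrite -ge0_integralD//.
  - apply: ge0_le_integral => //.
    + move=> s _; rewrite adde_ge0// mule_ge0 ?tail_ge0 ?lee_fin//; exact: ltW.
    + by apply: emeasurable_funD; exact: measurable_funeM.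
  - by move=> s _; rewrite mule_ge0 ?tail_ge0 ?lee_fin ?(ltW l0) ?(ltW l10).
  - exact: measurable_funeM.
  - by move=> s _; rewrite mule_ge0 ?tail_ge0 ?lee_fin ?(ltW l0) ?(ltW l10).
  - exact: measurable_funeM.
(* As [U], [V] and [M] are [m]-th powers of [x], [y] and their combination, this is [radon_ineq]
   multiplied by [c]. *)
apply: (@le_trans _ _ (M%:E * ((1 - l)%:E * (c * a ^+ m.+1 / U)%:E +
    l%:E * (c * b ^+ m.+1 / V)%:E))%E).
  suff : c * ((1 - l) * a + l * b) ^+ m.+1 <=
      M * ((1 - l) * (c * a ^+ m.+1 / U) + l * (c * b ^+ m.+1 / V)) by [].
  have := ler_wpM2l (ltW c_gt0) (radon_ineq m l01 a_gt0 b_gt0 x0 y0).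
  move/le_trans; apply; rewrite le_eqVlt; apply/orP; left; apply/eqP.
  by rewrite /U /V /M; ring.
have div W (I J : \bar R) (w : R) : 0 < W -> (w%:E <= I)%E ->
    (I = W%:E * J)%E -> ((w / W)%:E <= J)%E.
  move=> W0 wI IJ; rewrite -(@lee_pmul2l _ W%:E)// ?lte_fin// -IJ.
  by rewrite -EFinM mulrC divfK// gt_eqF.
rewrite lee_wpmul2l// ?lee_fin ?(ltW M0)// leeD//.
  by rewrite lee_wpmul2l ?lee_fin ?(ltW l10)//; exact: div U0 Ia IaE.
by rewrite lee_wpmul2l ?lee_fin ?(ltW l0)//; exact: div V0 Ib IbE.
Qed.

End borell_brascamp_lieb_line.

(** * Induction on the dimension by slicing *)

Section brunn_minkowski.
Context {R : realType}.
Local Notation leb := (@lebesgue_measure R).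

Definition convexV n (A : set 'rV[R]_n) := forall (l : R) x y, 0 < l < 1 ->
  A x -> A y -> A ((1 - l) *: x + l *: y).

Definition slice m (A : set 'rV[R]_m.+1) (s : R) : set 'rV[R]_m :=
  [set z | A (insertV ord0 (s, z))].

Lemma insertV_convex m (i : 'I_m.+1) (l s t : R) (z w : 'rV[R]_m) :
  insertV i ((1 - l) * s + l * t, (1 - l) *: z + l *: w) =
  (1 - l) *: insertV i (s, z) + l *: insertV i (t, w).
Proof.
by apply/rowP => j; rewrite !mxE; case: (unlift i j) => [k|]//; rewrite !mxE.
Qed.

Lemma slice_convex m (A : set 'rV[R]_m.+1) s : convexV A -> convexV (slice A s).
Proof.
move=> vA t z w t01 Az Aw; have := vA _ _ _ t01 Az Aw.
by rewrite -insertV_convex -mulrDl subrK mul1r.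
Qed.

Section slices.
Variables (m : nat) (A : set 'rV[R]_m.+1) (L : R).
Hypotheses (mA : measurable A) (AL : A `<=` cube m.+1 L).

Let pre : set (R * 'rV[R]_m) := insertV ord0 @^-1` A.

Let mpre : measurable pre.
Proof. by rewrite -[pre]setTI; exact: measurable_insertV. Qed.

Let sliceE s : slice A s = xsection pre s.
Proof. by rewrite xsectionE. Qed.

Lemma measurable_slice s : measurable (slice A s).
Proof. by rewrite sliceE; exact: measurable_xsection. Qed.

Lemma slice_cube s : slice A s `<=` cube m L.
Proof.
by move=> z /AL zL k; have := zL (lift ord0 k); rewrite insertV_lift.
Qed.

Definition slice_vol s : R := fine (lebesgue_rV R m (slice A s)).

Lemma slice_volE s : (slice_vol s)%:E = lebesgue_rV R m (slice A s).
Proof.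
rewrite fineK//; apply: (@lebesgue_cube_fin _ _ L); first exact: measurable_slice.
exact: slice_cube.
Qed.

Lemma slice_vol_ge0 s : 0 <= slice_vol s.
Proof. by rewrite fine_ge0. Qed.

Lemma measurable_slice_vol : measurable_fun setT slice_vol.
Proof.
apply/measurable_EFinP.
rewrite (_ : EFin \o _ = lebesgue_rV R m \o xsection pre).
  exact: measurable_fun_xsection.
by apply/funext => s /=; rewrite slice_volE sliceE.
Qed.

Lemma slice_vol_support s : slice_vol s != 0 -> `|s| <= L.
Proof.
move=> As; have [[z zA]|A0] := pselect (slice A s !=set0).
  by have := AL zA ord0; rewrite insertV_diag.
case/eqP: As; rewrite /slice_vol (_ : slice A s = set0) ?measure0//.
by apply/seteqP; split=> z // zA; apply: A0; exists z.
Qed.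

Lemma slice_vol_bounded s : slice_vol s <= fine (lebesgue_rV R m (cube m L)).
Proof.
rewrite fine_le//.
- by rewrite -slice_volE.
- by apply: (@lebesgue_cube_fin _ _ L) => //; exact: measurable_cube.
- apply: le_measure; last exact: slice_cube.
    by apply: mem_set; exact: measurable_slice.
  by apply: mem_set; exact: measurable_cube.
Qed.

Lemma slice_vol_integral :
  lebesgue_rV R m.+1 A = (\int[leb]_s (slice_vol s)%:E)%E.
Proof.
rewrite (lebesgue_rV_insert ord0 mA).
by apply: eq_integral => s _ /=; rewrite slice_volE sliceE.
Qed.

End slices.

Lemma lebesgue_rV0 (A : set 'rV[R]_0) :
  (~ A 0 /\ lebesgue_rV R 0 A = 0%E) \/ (A 0 /\ lebesgue_rV R 0 A = 1%E).
Proof.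
have [A0|A0] := pselect (A 0); [right|left]; split=> //=.
  by rewrite diracE mem_set.
by rewrite diracE memNset.
Qed.

(** With [c = 1] and [a], [b] the [m]-th roots of the volumes this is the usual form. Slices along
    the first coordinate satisfy the hypothesis of [bbl_line] by induction; in dimension 0 the claim
    is that [C] is nonempty when [A] and [B] are. *)
Theorem brunn_minkowski m (A B C : set 'rV[R]_m) (l L a b c : R) :
  measurable A -> measurable B -> measurable C ->
  convexV A -> convexV B ->
  A `<=` cube m L -> B `<=` cube m L -> C `<=` cube m L -> 0 < l < 1 ->
  (forall x y, A x -> B y -> C ((1 - l) *: x + l *: y)) ->
  0 < a -> 0 < b -> 0 < c ->
  ((c * a ^+ m)%:E <= lebesgue_rV R m A)%E ->
  ((c * b ^+ m)%:E <= lebesgue_rV R m B)%E ->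
  ((c * ((1 - l) * a + l * b) ^+ m)%:E <= lebesgue_rV R m C)%E.
Proof.
elim: m A B C l a b c => [|m IH] A B C l a b c mA mB mC vA vB AL BL CL l01 ABC
    a0 b0 c0.
  rewrite !expr0 !mulr1 => cA cB.
  have [[_ A0]|[A0 vol]] := lebesgue_rV0 A.
    by move: cA; rewrite A0 lee_fin leNgt c0.
  have [[_ B0]|[B0 _]] := lebesgue_rV0 B.
    by move: cB; rewrite B0 lee_fin leNgt c0.
  have [[C0 _]|[_ ->]] := lebesgue_rV0 C; last by rewrite -vol.
  by case: C0; have := ABC _ _ A0 B0; rewrite !scaler0 addr0.
have power (D E F : set 'rV[R]_m.+1) k : measurable D -> measurable E ->
    measurable F -> convexV D -> convexV E -> D `<=` cube m.+1 L ->
    E `<=` cube m.+1 L -> F `<=` cube m.+1 L -> 0 < k < 1 ->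
    (forall x y, D x -> E y -> F ((1 - k) *: x + k *: y)) ->
    forall x y u v w, 0 < u -> 0 < v -> 0 < w ->
    w * u ^+ m <= slice_vol D x -> w * v ^+ m <= slice_vol E y ->
    w * ((1 - k) * u + k * v) ^+ m <= slice_vol F ((1 - k) * x + k * y).
  move=> mD mE mF vD vE DL EL FL k01 DEF x y u v w u0 v0 w0 ux vy.
  rewrite -lee_fin (slice_volE mF FL).
  apply: (IH (slice D x) (slice E y)) => //.
  - exact: measurable_slice.
  - exact: measurable_slice.
  - exact: measurable_slice.
  - exact: slice_convex.
  - exact: slice_convex.
  - exact: slice_cube.
  - exact: slice_cube.
  - exact: slice_cube.
  - by move=> z1 z2 D1 E2; rewrite /slice/= insertV_convex; exact: DEF.
  - by rewrite -(slice_volE mD DL) lee_fin.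
  - by rewrite -(slice_volE mE EL) lee_fin.
(* Quasi-concavity of slice volumes: equal bases [1] and the smaller of the two volumes as common
   factor in [power]. *)
have level (D : set 'rV[R]_m.+1) : measurable D -> convexV D ->
    D `<=` cube m.+1 L -> forall r x y t, 0 <= r ->
    r < slice_vol D x -> r < slice_vol D y -> x <= t <= y -> r < slice_vol D t.
  move=> mD vD DL r x y t r0 rx ry /andP[].
  rewrite le_eqVlt => /orP[/eqP<-//|xt]; rewrite le_eqVlt => /orP[/eqP->//|ty].
  pose w := Num.min (slice_vol D x) (slice_vol D y).
  have rw : r < w by rewrite lt_min rx ry.
  pose k := (t - x) / (y - x).
  have yx : 0 < y - x by rewrite subr_gt0; exact: lt_trans ty.
  have k0 : 0 < k by rewrite divr_gt0// subr_gt0.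
  have k1 : k < 1 by rewrite ltr_pdivrMr// mul1r ltrD2r.
  have tE : t = (1 - k) * x + k * y.
    have : k * (y - x) = t - x by rewrite divfK// gt_eqF.
    lra.
  apply: (lt_le_trans rw); rewrite tE.
  have := @power D D D k mD mD mD vD vD DL DL DL _ _ x y 1 1 w.
  rewrite k0 k1 !expr1n !mulr1 subrK expr1n mulr1; apply=> //.
  - by move=> z1 z2; apply: vD; rewrite k0.
  - exact: le_lt_trans rw.
  - by rewrite ge_min lexx.
  - by rewrite ge_min lexx orbT.
have zero (D : set 'rV[R]_m.+1) : m = 0%N ->
    forall x, slice_vol D x = 0 \/ slice_vol D x = 1.
  move=> m0 x; rewrite /slice_vol; case: (m) m0 D => // _ D.
  by case: (lebesgue_rV0 (slice D x)) => -[_ ->]; [left|right].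
rewrite (slice_vol_integral mA AL) (slice_vol_integral mB BL).
rewrite (slice_vol_integral mC CL).
apply: (@bbl_line _ m _ _ _ l L (fine (lebesgue_rV R m (cube m L)))) => //.
- exact: measurable_slice_vol mA AL.
- exact: measurable_slice_vol mB BL.
- exact: measurable_slice_vol mC CL.
- exact: slice_vol_ge0.
- exact: slice_vol_ge0.
- exact: slice_vol_ge0.
- exact: slice_vol_bounded mA AL.
- exact: slice_vol_bounded mB BL.
- exact: slice_vol_support AL.
- exact: slice_vol_support BL.
- exact: level.
- exact: level.
- exact: zero.
- exact: zero.
- exact: power.
Qed.

End brunn_minkowski.

(** * One-dimensional marginals of uniform laws *)

Section marginals.
Context {R : realType}.
Local Notation leb := (@lebesgue_measure R).

Lemma measurable_dotp n (theta : 'rV[R]_n) :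
  measurable_fun setT (fun x => dotp x theta).
Proof.
apply: measurable_sum => i; apply: measurable_funM => //.
exact: measurable_coord.
Qed.

(* coordinates adapted to [theta]: the value of the linear form, then all
   coordinates but the [i]-th *)
Definition slab m (theta : 'rV[R]_m.+1) (i : 'I_m.+1) (p : R * 'rV[R]_m) :
    'rV[R]_m.+1 :=
  insertV i
    ((p.1 - \sum_k p.2 ord0 k * theta ord0 (lift i k)) / theta ord0 i, p.2).

Lemma dotp_insertV m (theta : 'rV[R]_m.+1) i p :
  dotp (insertV i p) theta =
  p.1 * theta ord0 i + \sum_k p.2 ord0 k * theta ord0 (lift i k).
Proof.
rewrite /dotp (bigD1_ord i)//= insertV_diag; congr (_ + _).
by apply: eq_bigr => k _; rewrite insertV_lift.
Qed.

Lemma dotp_slab m (theta : 'rV[R]_m.+1) i p : theta ord0 i != 0 ->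
  dotp (slab theta i p) theta = p.1.
Proof. by move=> t0; rewrite dotp_insertV/= divfK// subrK. Qed.

Lemma slab_surj m (theta : 'rV[R]_m.+1) i x : theta ord0 i != 0 ->
  slab theta i (dotp x theta, \row_k x ord0 (lift i k)) = x.
Proof.
move=> t0; apply/rowP => j; rewrite /slab !mxE.
case: unliftP => [k ->|->]; first by rewrite mxE.
rewrite /dotp (bigD1_ord i)//=; under [X in _ - X]eq_bigr do rewrite mxE.
by rewrite addrK mulfK.
Qed.

Lemma slab_lift m (theta : 'rV[R]_m.+1) i p k :
  slab theta i p ord0 (lift i k) = p.2 ord0 k.
Proof. by rewrite insertV_lift. Qed.

Lemma slab_affine m (theta : 'rV[R]_m.+1) i (a b s t : R) (z w : 'rV[R]_m) :
  slab theta i (a * s + b * t, a *: z + b *: w) =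
  a *: slab theta i (s, z) + b *: slab theta i (t, w).
Proof.
apply/rowP => j; rewrite !mxE; case: (unlift i j) => [k|]/=; rewrite ?mxE//.
have -> : \sum_k (a *: z + b *: w) ord0 k * theta ord0 (lift i k) =
    a * (\sum_k z ord0 k * theta ord0 (lift i k)) +
    b * (\sum_k w ord0 k * theta ord0 (lift i k)).
  rewrite !mulr_sumr -big_split/=; apply: eq_bigr => k _; rewrite !mxE.
  by ring.
by ring.
Qed.

Lemma measurable_slab m (theta : 'rV[R]_m.+1) i :
  measurable_fun [set: R * 'rV[R]_m] (slab theta i).
Proof.
apply: (measurableT_comp (measurable_insertV i)).
apply: measurable_fun_pair; last exact: measurable_snd.
apply: measurable_funM => //; apply: measurable_funB; first exact: measurable_fst.
apply: measurable_sum => k; apply: measurable_funM => //.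
exact: (measurableT_comp (@measurable_coord R m k) measurable_snd).
Qed.

(** The hyperplane slice projected along axis [i]. For [theta ord0 i != 0] the projection scales the
    volumes of all slices by one factor, so no surface measure is required. *)
Definition level m (theta : 'rV[R]_m.+1) i (A : set 'rV[R]_m.+1) (y : R) :
  set 'rV[R]_m := [set z | A (slab theta i (y, z))].

(** With the other coordinates fixed, the value of the form is affine in the [i]-th coordinate with
    slope [theta ord0 i]. Tonelli brings that integral inside, where the substitution is
    one-dimensional. *)
Lemma ge0_integral_slab m (theta : 'rV[R]_m.+1) i (g : 'rV[R]_m.+1 -> \bar R) :
  theta ord0 i != 0 -> measurable_fun setT g -> (forall x, 0 <= g x)%E ->
  (\int[lebesgue_rV R m.+1]_x g x =
   `|theta ord0 i|^-1%:E *
   \int[leb]_y \int[lebesgue_rV R m]_z g (slab theta i (y, z)))%E.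
Proof.
move=> t0 mg g0.
pose ins : measurableTypeR R * 'rV[R]_m -> 'rV[R]_m.+1 := insertV i.
have mins : measurable_fun setT ins by exact: measurable_insertV.
have -> : (\int[lebesgue_rV R m.+1]_x g x =
    \int[(leb \x lebesgue_rV R m)]_p g (insertV i p))%E.
  transitivity (\int[pushforward (leb \x lebesgue_rV R m) ins]_x g x)%E.
    apply: eq_measure_integral => B mB _.
    exact: lebesgue_rV_insert.
  exact: (@ge0_integral_pushforward _ _ _ _ R _ mins
    (leb \x lebesgue_rV R m)%E setT g).
rewrite fubini_tonelli2//; last exact: measurableT_comp.
pose gs : measurableTypeR R * 'rV[R]_m -> \bar R := g \o slab theta i.
have mgs : measurable_fun setT gs.
  by apply: measurableT_comp => //; exact: measurable_slab.
have gs0 p : (0 <= gs p)%E by exact: g0.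
have F1 := @fubini_tonelli1 _ _ _ _ _ leb (lebesgue_rV R m) gs mgs gs0.
have F2 := @fubini_tonelli2 _ _ _ _ _ leb (lebesgue_rV R m) gs mgs gs0.
have -> : (\int[leb]_y \int[lebesgue_rV R m]_z g (slab theta i (y, z)) =
    \int[lebesgue_rV R m]_z fubini_G leb gs z)%E by rewrite -F2 F1.
have c0 : 0 <= `|theta ord0 i|^-1 by rewrite invr_ge0.
rewrite -ge0_integralZl_EFin//; last 2 first.
- by move=> z _; apply: integral_ge0 => y _; exact: gs0.
- exact: (@measurable_fun_fubini_tonelli_G _ _ _ _ _ leb gs mgs gs0).
apply: eq_integral => z _.
pose b := \sum_k z ord0 k * theta ord0 (lift i k).
pose h y := g (slab theta i (y, z)).
have mh : measurable_fun setT h.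
  exact: (measurableT_comp mgs (pair2_measurable z)).
rewrite /fubini_G -[RHS](@ge0_integral_affine R (theta ord0 i) b h)//; last first.
  by move=> y; exact: g0.
apply: eq_integral => x _; rewrite /h /slab /=.
by rewrite addrK [_ * x]mulrC mulfK.
Qed.

Section level_sets.
Variables (m : nat) (theta : 'rV[R]_m.+1) (i : 'I_m.+1).
Variables (A : set 'rV[R]_m.+1) (L : R).
Hypotheses (t0 : theta ord0 i != 0) (mA : measurable A).
Hypothesis AL : A `<=` cube m.+1 L.

Lemma measurable_level y : measurable (level theta i A y).
Proof.
rewrite -[level _ _ _ _]setTI.
exact: (measurableT_comp (measurable_slab theta i) (pair1_measurable y)).
Qed.

Lemma level_cube y : level theta i A y `<=` cube m L.
Proof. by move=> z /AL zL k; have := zL (lift i k); rewrite slab_lift. Qed.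

Definition level_vol y : R := fine (lebesgue_rV R m (level theta i A y)).

Lemma level_volE y : (level_vol y)%:E = lebesgue_rV R m (level theta i A y).
Proof.
rewrite fineK//; apply: (@lebesgue_cube_fin _ _ L); first exact: measurable_level.
exact: level_cube.
Qed.

Lemma measurable_level_vol : measurable_fun setT level_vol.
Proof.
apply/measurable_EFinP.
have mpre : measurable (slab theta i @^-1` A).
  by rewrite -[X in measurable X]setTI; exact: measurable_slab.
rewrite (_ : EFin \o _ = lebesgue_rV R m \o xsection (slab theta i @^-1` A)).
  exact: measurable_fun_xsection.
by apply/funext => s /=; rewrite level_volE xsectionE.
Qed.

Lemma ge0_integral_level (psi : R -> \bar R) : measurable_fun setT psi ->
  (forall y, 0 <= psi y)%E ->
  (\int[lebesgue_rV R m.+1]_(x in A) psi (dotp x theta) =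
   `|theta ord0 i|^-1%:E * \int[leb]_y (psi y * (level_vol y)%:E))%E.
Proof.
move=> mpsi psi0; rewrite integral_mkcond (ge0_integral_slab t0)//.
- congr (_ * _)%E; apply: eq_integral => y _.
  rewrite level_volE.
  transitivity (\int[lebesgue_rV R m]_(z in level theta i A y) psi y)%E.
    rewrite [RHS]integral_mkcond; apply: eq_integral => z _.
    rewrite !patchE; have [zA|zA] := pselect (level theta i A y z).
      by rewrite !mem_set// dotp_slab.
    by rewrite !memNset.
  by rewrite integral_cst//; exact: measurable_level.
- apply/(measurable_restrictT _ mA)/measurable_funTS.
  exact: (measurableT_comp mpsi (measurable_dotp theta)).
- by move=> x; rewrite patchE; case: ifP.
Qed.

End level_sets.

Section uniform_law.
Variables (n : nat) (A : set 'rV[R]_n) (L : R).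
Hypotheses (mA : measurable A) (AL : A `<=` cube n L).
Context d (T : measurableType d) (P : probability T R) (X : {RV P >-> 'rV[R]_n}).
Hypothesis XA : uniform_on A X.

(** For a null set [A] the quotient defining the law is 0 on the whole space, which contradicts
    total mass 1. *)
Lemma uniform_vol_gt0 : 0 < fine (lebesgue_rV R n A).
Proof.
have Afin : lebesgue_rV R n A \is a fin_num by exact: lebesgue_cube_fin AL.
rewrite lt_neqAle fine_ge0// andbT eq_sym; apply/eqP => A0.
have := XA measurableT; rewrite probability_setT setTI -(fineK Afin) A0 mul0e.
by move=> /eqP; rewrite onee_eq0.
Qed.

Lemma ge0_expectation_uniform (h : 'rV[R]_n -> \bar R) :
  measurable_fun setT h -> (forall x, 0 <= h x)%E ->
  (\int[P]_t h (X t) =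
   (fine (lebesgue_rV R n A))^-1%:E * \int[lebesgue_rV R n]_(x in A) h x)%E.
Proof.
move=> mh h0; have v0 := uniform_vol_gt0.
have Afin : lebesgue_rV R n A \is a fin_num by exact: lebesgue_cube_fin AL.
have vi0 : 0 <= (fine (lebesgue_rV R n A))^-1 by rewrite invr_ge0 ltW.
rewrite -(ge0_integral_distribution X mh h0).
have XC : distribution P X (~` A) = 0%E.
  by rewrite XA ?setICl ?measure0 ?mul0e//; exact: measurableC.
rewrite (ge0_negligible_integral (measurableC mA))// setTD setCK.
rewrite -(ge0_integral_mscale _ mA (NngNum vi0))//; last exact: measurable_funTS.
apply: eq_measure_integral => B mB BA.
rewrite [LHS]XA// setIidl// muleC; congr (_ * _)%E.
by rewrite -[in LHS](fineK Afin) inver gt_eqF.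
Qed.

End uniform_law.

(** No integrability of [psi] is asked: both sides are the difference of the integrals of positive
    and negative parts, and these agree separately. *)
Definition has_density d (T : measurableType d) (P : probability T R)
    (Y : T -> R) (F : R -> R) :=
  [/\ measurable_fun setT F, forall y, 0 <= F y &
    forall psi : R -> R, measurable_fun setT psi ->
      ('E_P[psi \o Y] = \int[leb]_y (psi y * F y)%:E)%E].

Lemma uniform_marginal m (A : set 'rV[R]_m.+1) (L : R) (theta : 'rV[R]_m.+1) i
    d (T : measurableType d) (P : probability T R) (X : {RV P >-> 'rV[R]_m.+1}) :
  measurable A -> A `<=` cube m.+1 L -> uniform_on A X -> theta ord0 i != 0 ->
  exists2 c : R, 0 < c & has_density P (fun t => dotp (X t) theta)
    (fun y => c * level_vol theta i A y).
Proof.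
move=> mA AL XA t0.
have v0 := uniform_vol_gt0 mA AL XA.
pose c := (fine (lebesgue_rV R m.+1 A))^-1 * `|theta ord0 i|^-1.
have c0 : 0 < c by rewrite mulr_gt0 ?invr_gt0 ?normr_gt0.
have mV := measurable_level_vol theta i mA AL.
have V0 y : 0 <= level_vol theta i A y by exact: fine_ge0.
have ge0 (psi : R -> \bar R) : measurable_fun setT psi ->
    (forall y, 0 <= psi y)%E ->
    (\int[P]_t psi (dotp (X t) theta) =
     \int[leb]_y (psi y * (c * level_vol theta i A y)%:E))%E.
  move=> mpsi psi0.
  rewrite (ge0_expectation_uniform mA AL XA (h := fun x => psi (dotp x theta)))//.
    rewrite (ge0_integral_level t0 mA AL)// muleA -EFinM -ge0_integralZl_EFin//.
    - by apply: eq_integral => y _; rewrite EFinM muleCA.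
    - by move=> y _; apply: mule_ge0 => //; rewrite lee_fin.
    - by apply: emeasurable_funM => //; exact/measurable_EFinP.
    - exact: ltW.
  exact: (measurableT_comp mpsi (measurable_dotp theta)).
exists c => //; split.
- exact: measurable_funM.
- by move=> y; rewrite mulr_ge0// ltW.
move=> psi mpsi; rewrite expectation.unlock integralE [RHS]integralE.
have me : measurable_fun setT (EFin \o psi) by exact/measurable_EFinP.
have Ep := ge0 _ (measurable_funepos me) (@funepos_ge0 _ _ (EFin \o psi)).
have En := ge0 _ (measurable_funeneg me) (@funeneg_ge0 _ _ (EFin \o psi)).
have F0 y : 0 <= c * level_vol theta i A y by rewrite mulr_ge0// ltW.
apply: (congr2 (fun a b => a - b)%E).
  transitivity (\int[leb]_y
    ((EFin \o psi)^\+ y * (c * level_vol theta i A y)%:E))%E.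
    by rewrite -Ep; apply: eq_integral => t _; rewrite !funeposE.
  apply: eq_integral => y _.
  by rewrite !funeposE/= EFinM maxeMl ?mul0e// lee_fin.
transitivity (\int[leb]_y
  ((EFin \o psi)^\- y * (c * level_vol theta i A y)%:E))%E.
  by rewrite -En; apply: eq_integral => t _; rewrite !funenegE.
apply: eq_integral => y _.
by rewrite !funenegE/= -mulNr EFinM maxeMl ?mul0e// lee_fin.
Qed.

End marginals.

(** * Expectations over a bounded set: finiteness, continuity in the direction, isotropy *)

Section expectations.
Context {R : realType}.
Local Notation leb := (@lebesgue_measure R).

Definition C1 (phi : R -> R) :=
  (forall x, derivable phi x 1) /\ continuous (phi^`())%classic.

Lemma C1_continuous phi : C1 phi -> continuous phi.
Proof.
by move=> [dphi _] x; apply/differentiable_continuous/derivable1_diffP.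
Qed.

Lemma C1_lipschitz phi (M : R) : C1 phi -> 0 <= M -> exists2 C, 0 <= C &
  forall a b, `|a| <= M -> `|b| <= M -> `|phi a - phi b| <= C * `|a - b|.
Proof.
move=> [dphi cphi'] M0.
have [||c _ cmax] := @EVT_max R (fun x => `|(phi^`())%classic x|) (- M) M.
- by rewrite (le_trans _ M0)// oppr_le0.
- apply: continuous_subspaceT => x.
  exact: (continuous_comp (cphi' x) (@norm_continuous _ R _)).
exists `|(phi^`())%classic c| => //.
have lip a b : a < b -> `|a| <= M -> `|b| <= M ->
    `|phi b - phi a| <= `|(phi^`())%classic c| * `|b - a|.
  move=> ab aM bM.
  have [||d dab ->] := @MVT R phi (phi^`())%classic a b ab.
  - by move=> x _; split; [exact: dphi|rewrite derive1E].
  - apply: continuous_subspaceT; exact: C1_continuous.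
  rewrite normrM ler_wpM2r// cmax// in_itv/=.
  move: dab aM bM; rewrite in_itv/= !ler_norml.
  by move=> /andP[ad db] /andP[Ma _] /andP[_ bM]; apply/andP; split; lra.
move=> a b aM bM; have [ab|ba|->] := ltgtP a b.
- by rewrite distrC [X in _ * X]distrC; exact: lip.
- exact: lip.
- by rewrite !subrr normr0 mulr0.
Qed.

Lemma dotpBr n (x u v : 'rV[R]_n) : dotp x (u - v) = dotp x u - dotp x v.
Proof.
by rewrite /dotp -sumrB; apply: eq_bigr => i _; rewrite !mxE mulrBr.
Qed.

Lemma ler_coord_norm n (x : 'rV[R]_n) i : `|x ord0 i| <= `|x|.
Proof.
rewrite [leRHS]/Num.Def.normr/= mx_normrE.
by apply/bigmax_geP; right; exists (ord0, i).
Qed.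

Lemma dotp_bound n (L : R) (x v : 'rV[R]_n) : cube n L x ->
  `|dotp x v| <= n%:R * L * `|v|.
Proof.
move=> xL; rewrite (le_trans (ler_norm_sum _ _ _))//.
apply: (@le_trans _ _ (\sum_(i < n) L * `|v|)).
  by apply: ler_sum => i _; rewrite normrM ler_pM//; exact: ler_coord_norm.
by rewrite sumr_const card_ord -mulrA mulr_natl.
Qed.

Section uniform_expectation.
Variables (n : nat) (A : set 'rV[R]_n) (L : R).
Hypotheses (mA : measurable A) (AL : A `<=` cube n L).
Context d (T : measurableType d) (P : probability T R) (X : {RV P >-> 'rV[R]_n}).
Hypothesis XA : uniform_on A X.

Lemma uniform_le (h : 'rV[R]_n -> R) (B : R) : measurable_fun setT h ->
  (forall x, 0 <= h x) -> (forall x, A x -> h x <= B) ->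
  (\int[P]_t (h (X t))%:E <= B%:E)%E.
Proof.
move=> mh h0 hB; have v0 := uniform_vol_gt0 mA AL XA.
have Afin : lebesgue_rV R n A \is a fin_num by exact: lebesgue_cube_fin AL.
rewrite (ge0_expectation_uniform mA AL XA (h := EFin \o h))//; last first.
  exact/measurable_EFinP.
apply: (@le_trans _ _ ((fine (lebesgue_rV R n A))^-1%:E *
    \int[lebesgue_rV R n]_(x in A) B%:E))%E.
  rewrite lee_wpmul2l ?lee_fin ?invr_ge0 ?(ltW v0)//.
  apply: ge0_le_integral => //=.
  - by move=> x _; rewrite lee_fin.
  - by apply/measurable_EFinP; exact: measurable_funTS.
rewrite integral_cst//= -[X in (_ * (_ * X))%E](fineK Afin) muleCA -EFinM.
by rewrite mulVf ?mulr1// gt_eqF.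
Qed.

Lemma uniform_integrable (h : 'rV[R]_n -> R) (B : R) : measurable_fun setT h ->
  (forall x, A x -> `|h x| <= B) -> P.-integrable setT (fun t => (h (X t))%:E).
Proof.
move=> mh hB; apply/integrableP; split.
  by apply/measurable_EFinP; exact: measurableT_comp.
apply: le_lt_trans (ltry B).
apply: (@uniform_le (fun x => `|h x|) B) => //.
exact: measurableT_comp.
Qed.

Definition mean (f : T -> R) : R := fine ('E_P[f])%E.

Lemma meanE (h : 'rV[R]_n -> R) (B : R) : measurable_fun setT h ->
  (forall x, A x -> `|h x| <= B) -> ('E_P[fun t => h (X t)] =
    (mean (fun t => h (X t)))%:E)%E.
Proof.
move=> mh hB; rewrite fineK// expectation.unlock.
exact: integrable_fin_num (uniform_integrable mh hB).
Qed.

Lemma mean_dist (h1 h2 : 'rV[R]_n -> R) (B K : R) :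
  measurable_fun setT h1 -> measurable_fun setT h2 ->
  (forall x, A x -> `|h1 x| <= B) -> (forall x, A x -> `|h2 x| <= B) ->
  (forall x, A x -> `|h1 x - h2 x| <= K) ->
  `|mean (fun t => h1 (X t)) - mean (fun t => h2 (X t))| <= K.
Proof.
move=> mh1 mh2 h1B h2B h12; rewrite /mean expectation.unlock.
have i1 := uniform_integrable mh1 h1B.
have i2 := uniform_integrable mh2 h2B.
have mh12 : measurable_fun setT (fun x => h1 x - h2 x) by exact: measurable_funB.
have i12 := uniform_integrable mh12 h12.
rewrite -[X in `|X|](RintegralB (f1 := fun t => h1 (X t)) (f2 := fun t => h2 (X t)))//.
apply: (le_trans (le_normr_Rintegral _ i12)) => //.
rewrite -lee_fin /Rintegral fineK; last first.
  apply: integrable_fin_num => //; exact: (integrable_norm i12).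
apply: (@uniform_le (fun x => `|h1 x - h2 x|)) => //.
exact: measurableT_comp.
Qed.

Lemma dotp_bounded (phi : R -> R) (theta : 'rV[R]_n) : continuous phi ->
  exists B : R, forall x, A x -> `|phi (dotp x theta)| <= B.
Proof.
move=> cphi; pose M := n%:R * L * `|theta|.
have [[x0 Ax0]|A0] := pselect (A !=set0); last first.
  by exists 0 => x Ax; case: A0; exists x.
have M0 : 0 <= M by apply: le_trans (dotp_bound theta (AL Ax0)).
have [||c _ cmax] := @EVT_max R (fun x => `|phi x|) (- M) M.
- by rewrite (le_trans _ M0)// oppr_le0.
- apply: continuous_subspaceT => x.
  exact: (continuous_comp (cphi x) (@norm_continuous _ R _)).
exists `|phi c| => x Ax; apply: cmax.
by rewrite in_itv/= -ler_norml dotp_bound//; exact: AL.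
Qed.

Lemma expectation_dotp_fin (phi : R -> R) (theta : 'rV[R]_n) : continuous phi ->
  ('E_P[fun t => phi (dotp (X t) theta)] =
    (mean (fun t => phi (dotp (X t) theta)))%:E)%E.
Proof.
move=> cphi; have [B hB] := dotp_bounded theta cphi.
apply: (@meanE (fun x => phi (dotp x theta)) B) => //.
exact: (measurableT_comp (continuous_measurable_fun cphi) (measurable_dotp _)).
Qed.

(** For [theta] within distance 1 of [theta0], all scalar products stay in [[- M, M]], where [phi]
    is Lipschitz; hence the mean is controlled by [theta0 - theta]. *)
Lemma mean_dotp_continuous phi : C1 phi ->
  continuous (fun theta : 'rV[R]_n => mean (fun t => phi (dotp (X t) theta))).
Proof.
move=> phi1 theta0; have cphi := C1_continuous phi1.
pose L' := `|L|; have AL' : A `<=` cube n L'.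
  by move=> x Ax i; apply: (le_trans (AL Ax i)); exact: ler_norm.
pose M := n%:R * L' * (`|theta0| + 1).
have L'0 : 0 <= L' by exact: normr_ge0.
have M0 : 0 <= M by rewrite !mulr_ge0// addr_ge0.
have [C C0 lip] := C1_lipschitz phi1 M0.
apply/(@cvgrPdist_le _ R^o _ (nbhs theta0)) => eps eps0.
have nL'0 : 0 <= C * (n%:R * L') by rewrite !mulr_ge0.
have K0 : 0 < C * (n%:R * L') + 1 by rewrite ltr_wpDl.
near=> theta.
have dth : `|theta0 - theta| <= Num.min 1 (eps / (C * (n%:R * L') + 1)).
  near: theta; apply: (@cvgr_dist_le _ _ _ (nbhs theta0)) => //.
  by rewrite lt_min ltr01 divr_gt0.
move: dth; rewrite le_min => /andP[d1 d2].
have thM : `|theta| <= `|theta0| + 1.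
  rewrite -[theta](subrK theta0) (le_trans (ler_normD _ _))//.
  by rewrite addrC lerD2l distrC.
have mphi th : measurable_fun setT (fun x => phi (dotp x th)).
  exact: (measurableT_comp (continuous_measurable_fun cphi) (measurable_dotp _)).
have [B1 hB1] := dotp_bounded theta0 cphi.
have [B2 hB2] := dotp_bounded theta cphi.
apply: (@mean_dist (fun x => phi (dotp x theta0)) (fun x => phi (dotp x theta))
    (Num.max B1 B2)) => //.
- by move=> x Ax; rewrite le_max hB1.
- by move=> x Ax; rewrite le_max hB2// orbT.
move=> x Ax.
have bnd v : `|v| <= `|theta0| + 1 -> `|dotp x v| <= M.
  by move=> vb; rewrite (le_trans (dotp_bound v (AL' _ Ax)))// ler_wpM2l// mulr_ge0.
rewrite (le_trans (lip _ _ (bnd _ _) (bnd _ _)))//; first by rewrite lerDl.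
rewrite -dotpBr (le_trans (ler_wpM2l C0 (dotp_bound _ (AL' _ Ax))))//.
rewrite mulrA; apply: (@le_trans _ _ ((C * (n%:R * L') + 1) * `|theta0 - theta|)).
  by rewrite ler_wpM2r// lerDl.
by rewrite mulrC -ler_pdivlMr.
Unshelve. all: by end_near. Qed.

Hypothesis Xiso : isotropic_rv X.

Lemma isotropic_mean (theta : 'rV[R]_n) : ('E_P[fun t => dotp (X t) theta] = 0)%E.
Proof.
rewrite expectation.unlock.
have -> : (fun t => (dotp (X t) theta)%:E) =
    (fun t => \sum_i ((theta ord0 i)%:E * (X t ord0 i)%:E))%E.
  apply/funext => t; rewrite -sumEFin; apply: eq_bigr => i _.
  by rewrite mulrC EFinM.
have iX i : P.-integrable setT (fun t => (X t ord0 i)%:E).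
  apply: (@uniform_integrable (fun x => x ord0 i) L) => [|x /AL] //.
  exact: measurable_coord.
rewrite integral_sum//; last by move=> i; exact: integrableZl.
rewrite big1// => i _; rewrite integralZl//.
by have := Xiso.1 i; rewrite expectation.unlock => ->; rewrite mule0.
Qed.

Lemma isotropic_second_moment (theta : 'rV[R]_n) :
  ('E_P[fun t => ((dotp (X t) theta) ^+ 2)%R] = (dotp theta theta)%:E)%E.
Proof.
rewrite expectation.unlock.
have -> : (fun t => ((dotp (X t) theta) ^+ 2)%:E) =
    (fun t => \sum_(p : 'I_n * 'I_n)
      ((theta ord0 p.1 * theta ord0 p.2)%:E *
       (X t ord0 p.1 * X t ord0 p.2)%:E))%E.
  apply/funext => t; rewrite expr2 /dotp big_distrlr/= pair_big/= -sumEFin.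
  by apply: eq_bigr => p _; rewrite -EFinM; congr EFin; ring.
have iX (p : 'I_n * 'I_n) :
    P.-integrable setT (fun t => (X t ord0 p.1 * X t ord0 p.2)%:E).
  apply: (@uniform_integrable (fun x => x ord0 p.1 * x ord0 p.2) (L * L)).
    by apply: measurable_funM; exact: measurable_coord.
  by move=> x /AL xL; rewrite normrM ler_pM// xL.
rewrite integral_sum//; last by move=> p; exact: integrableZl.
have E (p : 'I_n * 'I_n) : (\int[P]_t ((theta ord0 p.1 * theta ord0 p.2)%:E *
       (X t ord0 p.1 * X t ord0 p.2)%:E) =
     (theta ord0 p.1 * theta ord0 p.2 * (p.1 == p.2)%:R)%:E)%E.
  rewrite integralZl//; have := Xiso.2 p.1 p.2; rewrite expectation.unlock.
  by move=> ->; rewrite EFinM.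
under eq_bigr do rewrite E.
rewrite sumEFin -(pair_big xpredT xpredT
  (fun i j => theta ord0 i * theta ord0 j * (i == j)%:R))/=; congr EFin.
apply: eq_bigr => i _; rewrite (bigD1 i)//= eqxx mulr1 big1 ?addr0// => j ji.
by rewrite eq_sym (negbTE ji) mulr0.
Qed.

End uniform_expectation.
End expectations.

(** * Comparing two densities with equal moments *)

Section density_comparison.
Context {R : realType}.
Local Notation leb := (@lebesgue_measure R).

Section level_volume.
Variables (m : nat) (theta : 'rV[R]_m.+1) (i : 'I_m.+1).
Variables (A : set 'rV[R]_m.+1) (L : R).
Hypotheses (t0 : theta ord0 i != 0) (mA : measurable A).
Hypothesis AL : A `<=` cube m.+1 L.

Lemma level_vol_support y : level_vol theta i A y != 0 ->
  `|y| <= m.+1%:R * L * `|theta|.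
Proof.
move=> Ay; have [[z zA]|A0] := pselect (level theta i A y !=set0).
  by rewrite -[y]/((y, z).1) -(dotp_slab _ t0); exact/dotp_bound/AL.
case/eqP: Ay; rewrite /level_vol (_ : level _ _ _ _ = set0) ?measure0//.
by apply/seteqP; split=> z // zA; apply: A0; exists z.
Qed.

(** Brunn's slice theorem: [slab] is affine, so combinations of points of two levels fall into the
    combined level. The density factor is absorbed by the free constant, which becomes [k / c]. *)
Lemma level_vol_power_concave (c : R) : 0 < c -> convexV A ->
  power_concave m (fun y => c * level_vol theta i A y).
Proof.
move=> c0 vA x y l a b k l01 a0 b0 k0 kx ky.
have scale (u w : R) : k * u <= c * w = (k / c * u <= w).
  by rewrite mulrAC ler_pdivrMr// [w * c]mulrC.
have vlevel z : convexV (level theta i A z).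
  move=> t u v t01 Au Av; rewrite /level/= (_ : z = (1 - t) * z + t * z); last by ring.
  by rewrite slab_affine; exact: vA.
rewrite scale -lee_fin (level_volE _ _ mA AL).
apply: (@brunn_minkowski R m (level theta i A x) (level theta i A y) _ l L) => //.
- exact: measurable_level.
- exact: measurable_level.
- exact: measurable_level.
- exact: level_cube.
- exact: level_cube.
- exact: level_cube.
- by move=> u v Au Av; rewrite /level/= slab_affine; exact: vA.
- by rewrite divr_gt0.
- by rewrite -(level_volE _ _ mA AL) lee_fin -scale.
- by rewrite -(level_volE _ _ mA AL) lee_fin -scale.
Qed.

End level_volume.

Section densities.
Context d (T : measurableType d) (P : probability T R) (Y : T -> R).
Context d' (T' : measurableType d') (Q : probability T' R) (Z : T' -> R).
Variables F G : R -> R.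
Hypotheses (PF : has_density P Y F) (QG : has_density Q Z G).
Variable L : R.
Hypotheses (FL : forall t, F t != 0 -> `|t| <= L).
Hypotheses (GL : forall t, G t != 0 -> `|t| <= L).

Lemma density_integrable d0 (T0 : measurableType d0) (P0 : probability T0 R)
    (Y0 : T0 -> R) (F0 : R -> R) : has_density P0 Y0 F0 ->
  (forall t, F0 t != 0 -> `|t| <= L) -> integrable_vs_continuous F0.
Proof.
move=> [mF F_ge0 EF] F0L psi cpsi.
have [F00|[t0 Ft0]] : (forall t, F0 t = 0) \/ exists t, F0 t != 0.
  apply: contrapT => /not_orP[nF /forallNP H]; apply: nF => t.
  by apply/eqP; apply: contrapT => /negP /H.
  under eq_fun do rewrite F00 mulr0.
  exact: integrable0.
have L0 : 0 <= L by exact: le_trans (F0L _ Ft0).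
have [||c _ cmax] := @EVT_max R (fun x => `|psi x|) (- L) L.
- by rewrite (le_trans _ L0)// oppr_le0.
- apply: continuous_subspaceT => x.
  exact: (continuous_comp (cpsi x) (@norm_continuous _ R _)).
have mpsi : measurable_fun setT psi by exact: continuous_measurable_fun.
apply: (@le_integrable _ _ _ leb _ measurableT _
    (fun t => (`|psi c|%:E * (F0 t)%:E)%E)).
- by apply/measurable_EFinP; exact: measurable_funM.
- move=> t _; rewrite /= lee_fin !normrM normr_id.
  have [->|Ft] := eqVneq (F0 t) 0; first by rewrite !normr0 !mulr0.
  rewrite ler_wpM2r// cmax// in_itv/= -ler_norml.
  exact: F0L.
apply: integrableZl => //; apply/integrableP; split.
  exact/measurable_EFinP.
under eq_integral do rewrite gee0_abs ?lee_fin//.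
(* The integral of the density is the expectation of the constant 1; no bound on [F0] itself is at
   hand. *)
have := EF (cst 1) (@measurable_cst _ _ _ _ _ _).
under [X in _ = X]eq_integral do rewrite mul1r.
by move=> <-; rewrite (_ : cst 1 \o Y0 = cst 1)// expectation_cst ltry.
Qed.

Let iF := density_integrable PF FL.
Let iG := density_integrable QG GL.

Let FGE (psi : R -> R) : continuous psi ->
  (\int[leb]_t (psi t * (F t - G t))%:E =
   'E_P[psi \o Y] - 'E_Q[psi \o Z])%E /\
  ('E_P[psi \o Y])%E \is a fin_num /\ ('E_Q[psi \o Z])%E \is a fin_num.
Proof.
move=> cpsi; have mpsi := continuous_measurable_fun cpsi.
have [_ _ /(_ psi mpsi) EP] := PF; have [_ _ /(_ psi mpsi) EQ] := QG.
rewrite EP EQ; split.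
  rewrite -integralB//; [|exact: iF|exact: iG].
  by apply: eq_integral => t _; rewrite mulrBr EFinB.
by split; apply: integrable_fin_num => //; [exact: iF|exact: iG].
Qed.

Let iFG : integrable_vs_continuous (fun t => F t - G t).
Proof.
move=> psi cpsi.
rewrite (_ : (fun t => _) = ((fun t => (psi t * F t)%:E) \-
    (fun t => (psi t * G t)%:E))%E).
  by apply: integrableB => //; [exact: iF|exact: iG].
by apply/funext => t; rewrite mulrBr EFinB.
Qed.

Let moments k : (forall j, (j < k)%N ->
    'E_P[(fun y => y ^+ j)%R \o Y] = 'E_Q[(fun y => y ^+ j)%R \o Z])%E ->
  forall j, (j < k)%N -> (\int[leb]_t (t ^+ j * (F t - G t))%:E = 0)%E.
Proof.
move=> mom j jk; have cX : continuous (fun y : R => y ^+ j).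
  by move=> x; exact: exprn_continuous.
have [-> [_ f]] := FGE cX.
by rewrite mom// subee.
Qed.

Lemma density_comparison k phi (s : seq R) : (0 < k)%N -> class_C k phi ->
  (forall x, 0 < phi^`(k)%classic x) ->
  (forall j, (j < k)%N ->
    'E_P[(fun y => y ^+ j)%R \o Y] = 'E_Q[(fun y => y ^+ j)%R \o Z])%E ->
  size s = k -> (forall t, \prod_(x <- s) (t - x) * (F t - G t) <= 0) ->
  ('E_P[phi \o Y] <= 'E_Q[phi \o Z])%E.
Proof.
move=> k0 phik phi_gt0 mom szs pat.
have cphi : continuous phi.
  move=> x; apply/differentiable_continuous/derivable1_diffP.
  exact: (phik.1 0%N).
have [E [f1 f2]] := FGE cphi.
have := sign_pattern_le0 k0 phik phi_gt0 iFG (moments mom) szs pat.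
by rewrite E leeBlDr// add0e.
Qed.

(** Here one moment more agrees than there are nodes, so the densities coincide almost
    everywhere. *)
Lemma density_rigidity (phi : R -> R) (s : seq R) : continuous phi ->
  (forall j, (j <= size s)%N ->
    'E_P[(fun y => y ^+ j)%R \o Y] = 'E_Q[(fun y => y ^+ j)%R \o Z])%E ->
  (forall t, \prod_(x <- s) (t - x) * (F t - G t) <= 0) ->
  ('E_P[phi \o Y] = 'E_Q[phi \o Z])%E.
Proof.
move=> cphi mom pat.
have [E [f1 f2]] := FGE cphi; move: E.
rewrite integral_ae0//; last first.
  apply: (@sign_pattern_ae0 _ _ s [::]) => //.
  by move=> j js; apply: (@moments (size s).+1).
rewrite -(fineK f1) -(fineK f2) -EFinB => -[] /esym /eqP.
by rewrite subr_eq0 => /eqP ->.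
Qed.

End densities.
End density_comparison.

(** * Simplices *)

Section simplices.
Context {R : realType}.
Local Notation leb := (@lebesgue_measure R).

Lemma dotpDl n (a b : R) (x y v : 'rV[R]_n) :
  dotp (a *: x + b *: y) v = a * dotp x v + b * dotp y v.
Proof.
rewrite /dotp !mulr_sumr -big_split/=; apply: eq_bigr => i _.
by rewrite !mxE; ring.
Qed.

Lemma dotpDr n (a b : R) (x u v : 'rV[R]_n) :
  dotp x (a *: u + b *: v) = a * dotp x u + b * dotp x v.
Proof.
rewrite /dotp !mulr_sumr -big_split/=; apply: eq_bigr => i _.
by rewrite !mxE; ring.
Qed.

Lemma dotp_suml n (I : finType) (c : I -> R) (x : I -> 'rV[R]_n) v :
  dotp (\sum_i c i *: x i) v = \sum_i c i * dotp (x i) v.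
Proof.
rewrite /dotp; under eq_bigr do rewrite summxE mulr_suml.
rewrite exchange_big/=; apply: eq_bigr => i _; rewrite mulr_sumr.
by apply: eq_bigr => j _; rewrite mxE mulrA.
Qed.

(** The affine function [dotp x (w i) + k i] is the [i]-th barycentric coordinate. Affine
    independence makes the matrix with rows [(1, v i)] invertible; column [i] of the inverse holds
    [k i] followed by [w i]. *)
Lemma barycentric_coordinates n (v : 'I_n.+1 -> 'rV[R]_n) :
  affinely_independent v ->
  exists (w : 'I_n.+1 -> 'rV[R]_n) (k : 'I_n.+1 -> R),
    (forall i j, dotp (v j) (w i) + k i = (i == j)%:R) /\
    (forall x, \sum_i (dotp x (w i) + k i) = 1 /\
      x = \sum_i (dotp x (w i) + k i) *: v i).
Proof.
move=> vi.
pose M : 'M[R]_n.+1 := \matrix_(i, j) insertV ord0 (1, v i) ord0 j.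
have Mrow (u : 'rV[R]_n.+1) j : (u *m M) ord0 j =
    insertV ord0 (\sum_i u ord0 i, \sum_i u ord0 i *: v i) ord0 j.
  rewrite !mxE; case: unliftP => [l ->|->] /=.
    rewrite summxE; apply: eq_bigr => i _; rewrite !mxE liftK/=.
    by rewrite mulrC.
  by apply: eq_bigr => i _; rewrite !mxE unlift_none mulr1.
have Munit : M \in unitmx.
  rewrite -row_free_unit -kermx_eq0; apply/eqP/row_matrixP => r.
  rewrite row0; set u := row r _.
  have uM : u *m M = 0 by apply/sub_kermxP; rewrite row_sub.
  have u0 : forall i, u ord0 i = 0.
    apply: vi.
      by have := Mrow u ord0; rewrite uM insertV_diag mxE /= => <-.
    apply/rowP => l; have := Mrow u (lift ord0 l).
    by rewrite uM insertV_lift mxE /= => <-; rewrite mxE.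
  by apply/rowP => i; rewrite u0 mxE.
pose N := invmx M.
exists (fun i => \row_j N (lift ord0 j) i), (fun i => N ord0 i).
have wE (x : 'rV[R]_n) i :
    dotp x (\row_j N (lift ord0 j) i) + N ord0 i =
    (insertV ord0 (1, x) *m N) ord0 i.
  rewrite [RHS]mxE big_ord_recl insertV_diag mul1r addrC; congr (_ + _).
  by apply: eq_bigr => j _; rewrite insertV_lift mxE.
split=> [i j|x].
  rewrite wE.
  have -> : insertV ord0 (1, v j) = row j M by apply/rowP => l; rewrite !mxE.
  by rewrite -row_mul mulmxV// !mxE eq_sym.
have xE : insertV ord0 (1, x) *m N *m M = insertV ord0 (1, x).
  by rewrite -mulmxA mulVmx// mulmx1.
split.
  under eq_bigr do rewrite wE.
  by have := Mrow (insertV ord0 (1, x) *m N) ord0; rewrite xE !insertV_diag/=.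
under eq_bigr do rewrite wE.
apply/rowP => l; have := Mrow (insertV ord0 (1, x) *m N) (lift ord0 l).
by rewrite xE !insertV_lift.
Qed.

Section simplex.
Variables (n : nat) (v w : 'I_n.+1 -> 'rV[R]_n) (k : 'I_n.+1 -> R).
Hypothesis vw : forall i j, dotp (v j) (w i) + k i = (i == j)%:R.
Hypothesis bary : forall x, \sum_i (dotp x (w i) + k i) = 1 /\
  x = \sum_i (dotp x (w i) + k i) *: v i.

Let beta i x : R := dotp x (w i) + k i.

Let beta_affine i (a b : R) x y : a + b = 1 ->
  beta i (a *: x + b *: y) = a * beta i x + b * beta i y.
Proof.
by move=> ab; rewrite /beta dotpDl -[X in _ + X]mul1r -ab; ring.
Qed.

Lemma simplexE : convex_hull v = [set x | forall i, 0 <= dotp x (w i) + k i].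
Proof.
apply/seteqP; split=> [x [c [c0 c1 ->]] i|x x0]/=; last first.
  by exists (fun i => beta i x); have [? ?] := bary x.
suff -> : dotp (\sum_i c i *: v i) (w i) + k i = c i by [].
rewrite dotp_suml -[X in _ + X]mul1r -c1 mulr_suml -big_split/=.
rewrite (bigD1 i)//= -mulrDr vw eqxx mulr1 big1 ?addr0// => j ji.
by rewrite -mulrDr vw eq_sym (negbTE ji) mulr0.
Qed.

Lemma measurable_simplex : measurable (convex_hull v).
Proof.
rewrite simplexE.
rewrite (_ : [set x | _] = \bigcap_(i in [set: 'I_n.+1])
    ((fun x => dotp x (w i) + k i) @^-1` `[0, +oo[)).
  apply: fin_bigcap_measurable => // i _.
  rewrite -[X in measurable X]setTI.
  apply: (_ : measurable_fun _ _) => //; apply: measurable_funD => //.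
  exact: measurable_dotp.
apply/seteqP; split=> x /= x0 i; first by rewrite /= in_itv/= andbT.
by have := x0 i I; rewrite /= in_itv/= andbT.
Qed.

Lemma simplex_convex : convexV (convex_hull v).
Proof.
rewrite simplexE => l x y /andP[l0 l1] x0 y0 i /=.
rewrite -/(beta i _) beta_affine ?subrK//.
apply: addr_ge0; apply: mulr_ge0; [|exact: x0| |exact: y0]; apply: ltW => //.
by rewrite subr_gt0.
Qed.

Lemma simplex_cube : exists L, convex_hull v `<=` cube n L.
Proof.
exists (\sum_i `|v i|) => x [c [c0 c1 ->]] j.
rewrite summxE (le_trans (ler_norm_sum _ _ _))// ler_sum// => i _.
rewrite mxE normrM ger0_norm// (le_trans _ (ler_coord_norm (v i) j))//.
rewrite ler_piMl// -c1 (bigD1 i)//= lerDl sumr_ge0//.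
Qed.

End simplex.

Section simplex_levels.
Variables (m : nat) (v w : 'I_m.+2 -> 'rV[R]_m.+1) (k : 'I_m.+2 -> R).
Hypothesis vw : forall i j, dotp (v j) (w i) + k i = (i == j)%:R.
Hypothesis bary : forall x, \sum_i (dotp x (w i) + k i) = 1 /\
  x = \sum_i (dotp x (w i) + k i) *: v i.
Variables (theta : 'rV[R]_m.+1) (i0 : 'I_m.+1).
Hypothesis t0 : theta ord0 i0 != 0.

Let D := convex_hull v.
Let V := level_vol theta i0 D.
Let beta i x : R := dotp x (w i) + k i.

Let beta_affine i (a b : R) x y : a + b = 1 ->
  beta i (a *: x + b *: y) = a * beta i x + b * beta i y.
Proof.
by move=> ab; rewrite /beta dotpDl -[X in _ + X]mul1r -ab; ring.
Qed.

Let mD : measurable D. Proof. exact: measurable_simplex vw bary. Qed.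

(** The homothety of ratio [r] centred at [v a] multiplies every barycentric coordinate other than
    the [a]-th by [r], hence preserves those constraints. The hypothesis says that at height [z]
    they imply the remaining one. *)
Lemma level_vol_homothety (a : 'I_m.+2) (z r : R) : 0 < r -> r <= 1 ->
  (forall x, dotp x theta = z -> (forall j, j != a -> 0 <= beta j x) ->
    0 <= beta a x) ->
  V (r * z + (1 - r) * dotp (v a) theta) = r ^+ m * V z.
Proof.
move=> r0 r1 za; rewrite /V /level_vol.
pose w0 := \row_l v a ord0 (lift i0 l).
have vaE : slab theta i0 (dotp (v a) theta, w0) = v a by exact: slab_surj.
have levelE : (fun y => r *: y + (1 - r) *: w0) @^-1`
    level theta i0 D (r * z + (1 - r) * dotp (v a) theta) = level theta i0 D z.
  apply/seteqP; split=> y.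
    rewrite /level/= slab_affine vaE /D (simplexE vw bary) /= => H.
    set x := slab theta i0 (z, y) in H *.
    have betaj j : j != a -> 0 <= beta j x.
      move=> ja; have := H j; rewrite -/(beta j _) beta_affine ?subrKC//.
      by rewrite /beta vw (negbTE ja) mulr0 addr0 pmulr_rge0.
    move=> j; have [->|/betaj//] := eqVneq j a.
    by apply: za => //; rewrite /x dotp_slab.
  rewrite /level/= slab_affine vaE /D (simplexE vw bary) /= => H j.
  rewrite -/(beta j _) beta_affine ?subrKC//.
  apply: addr_ge0; apply: mulr_ge0; [exact: ltW|exact: H| |].
    by rewrite subr_ge0.
  by rewrite /beta vw.
have mL y : measurable (level theta i0 D y) by exact: measurable_level.
rewrite (lebesgue_rV_homothety ((1 - r) *: w0) r0 (mL _)) levelE.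
have [L DL] := simplex_cube v.
rewrite -(level_volE theta i0 mD DL).
by [].
Qed.

Let D_beta_ge0 x i : D x -> 0 <= beta i x.
Proof. by rewrite /D (simplexE vw bary); exact. Qed.

Let D_beta_le1 x i : D x -> beta i x <= 1.
Proof.
move=> Dx; rewrite -(bary x).1 (bigD1 i)//= lerDl sumr_ge0// => j _.
exact: D_beta_ge0.
Qed.

Let D_beta_eq1 x a : D x -> beta a x = 1 -> x = v a.
Proof.
move=> Dx xa.
have x0 j : j != a -> beta j x = 0.
  move=> ja; apply/eqP; rewrite eq_le D_beta_ge0// andbT.
  have := (bary x).1; rewrite (bigD1 a)//= -/(beta a x) xa (bigD1 j)//=.
  move=> E; rewrite -(lerD2l 1) addr0 -[leRHS]E addrA lerDl sumr_ge0// => l _.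
  exact: D_beta_ge0.
rewrite (bary x).2 (bigD1 a)//= -/(beta a x) xa scale1r big1 ?addr0// => j ja.
by rewrite -/(beta j x) x0// scale0r.
Qed.

(** The limit [r = 0] of the homothety: the slice shrinks to the vertex, and a point is null in
    positive dimension. *)
Lemma level_vol_vertex (a : 'I_m.+2) : (0 < m)%N ->
  (forall x, D x -> dotp x theta = dotp (v a) theta -> beta a x = 1) ->
  V (dotp (v a) theta) = 0.
Proof.
move=> m0 va1.
have va x : D x -> dotp x theta = dotp (v a) theta -> x = v a.
  by move=> Dx xa; apply: D_beta_eq1 => //; exact: va1.
rewrite /V /level_vol.
pose w0 := \row_l v a ord0 (lift i0 l).
have sub : level theta i0 D (dotp (v a) theta) `<=` box (fun l => [set w0 ord0 l]).
  move=> y Dy l /=; rewrite -[LHS](slab_lift theta i0 (dotp (v a) theta, y)).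
  by rewrite (va _ Dy) ?dotp_slab// mxE.
have : (lebesgue_rV R m (level theta i0 D (dotp (v a) theta)) <= 0)%E.
  apply: (@le_trans _ _ (lebesgue_rV R m (box (fun l => [set w0 ord0 l])))).
    apply: le_measure => //; apply: mem_set; first exact: measurable_level.
    by apply: measurable_box.
  rewrite lebesgue_boxE//.
  case: (m) m0 w0 {sub} => // m' _ w0; rewrite big_ord_recl lebesgue_measure_set1.
  by rewrite mul0e.
by rewrite measure_le0 => /eqP ->.
Qed.

Lemma level_vol_ray (a : 'I_m.+2) (z r : R) : (0 < m)%N -> 0 <= r <= 1 ->
  (forall x, dotp x theta = z -> (forall j, j != a -> 0 <= beta j x) ->
    0 <= beta a x) ->
  (forall x, D x -> dotp x theta = dotp (v a) theta -> beta a x = 1) ->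
  V (r * z + (1 - r) * dotp (v a) theta) = r ^+ m * V z.
Proof.
move=> m0 /andP[]; rewrite le_eqVlt => /orP[/eqP<- _ _ va|r0 r1 za _].
  by rewrite mul0r subr0 mul1r add0r level_vol_vertex// expr0n gtn_eqF// mul0r.
exact: level_vol_homothety.
Qed.

Lemma level_vol_outside t : (forall x, D x -> dotp x theta != t) -> V t = 0.
Proof.
move=> nt; rewrite /V /level_vol (_ : level _ _ _ _ = set0) ?measure0//.
apply/seteqP; split=> y // Dy; have := nt _ Dy.
by rewrite dotp_slab// eqxx.
Qed.

(** By [fE] the form is [z + rho * ((1 - s) * beta b x - s * beta a x)]. At height [z] the two terms
    balance, so either coordinate is nonnegative as soon as the other is, when its weight is
    positive: this is what the homothety at each of the two vertices needs. An extreme value forces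
    the corresponding coordinate to be 1. *)
Lemma simplex_tent (a b : 'I_m.+2) (s rho z : R) : (0 < m)%N -> a != b ->
  0 <= s <= 1 -> 0 < rho ->
  theta = rho *: ((1 - s) *: w b + (- s) *: w a) ->
  z = rho * (s * k a - (1 - s) * k b) ->
  tent m (z - rho * s) z (z + rho * (1 - s)) (V z) V.
Proof.
move=> m0 ab /andP[s0 s1] rho0 thetaE zE.
have fE x : dotp x theta = z + rho * ((1 - s) * beta b x - s * beta a x).
  have := dotpDr rho 0 x ((1 - s) *: w b + (- s) *: w a) 0.
  rewrite scale0r addr0 -thetaE mul0r addr0 => ->.
  by rewrite dotpDr zE /beta; ring.
have fa : dotp (v a) theta = z - rho * s.
  by rewrite fE /beta !vw eqxx eq_sym (negbTE ab) /=; ring.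
have fb : dotp (v b) theta = z + rho * (1 - s).
  by rewrite fE /beta !vw eqxx (negbTE ab) /=; ring.
have s1' : 0 <= 1 - s by rewrite subr_ge0.
have fDge x : D x -> - s <= (1 - s) * beta b x - s * beta a x.
  move=> Dx; have := mulr_ge0 s1' (D_beta_ge0 b Dx).
  by have := ler_wpM2l s0 (D_beta_le1 a Dx); lra.
have fDle x : D x -> (1 - s) * beta b x - s * beta a x <= 1 - s.
  move=> Dx; have := mulr_ge0 s0 (D_beta_ge0 a Dx).
  by have := ler_wpM2l s1' (D_beta_le1 b Dx); lra.
split.
- move=> t tp; apply: level_vol_outside => x Dx.
  by rewrite fE gt_eqF// (lt_le_trans tp)// lerD2l -mulrN ler_pM2l// fDge.
- move=> t tq; apply: level_vol_outside => x Dx.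
  by rewrite fE lt_eqF// (le_lt_trans _ tq)// lerD2l ler_pM2l// fDle.
- rewrite ltrBlDr ltrDl pmulr_rgt0// => s_gt0 t /andP[pt tz].
  have rs0 : 0 < rho * s by rewrite mulr_gt0.
  pose r := (t - (z - rho * s)) / (z - (z - rho * s)).
  have den : z - (z - rho * s) = rho * s by ring.
  have r01 : 0 <= r <= 1.
    rewrite /r den divr_ge0 ?subr_ge0// ?(ltW rs0)//=.
    by rewrite ler_pdivrMr// mul1r; lra.
  have tE : t = r * z + (1 - r) * dotp (v a) theta.
    rewrite fa /r den; field; rewrite gt_eqF//=.
    by rewrite gt_eqF.
  rewrite -/r mulrC {1}tE; apply: level_vol_ray => //.
  + move=> x; rewrite fE => /(canRL (addKr _)); rewrite addNr => /eqP.
    rewrite mulf_eq0 gt_eqF//= subr_eq0 => /eqP E /(_ b); rewrite eq_sym ab.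
    by move=> /(_ isT) bx; rewrite -(pmulr_rge0 _ s_gt0) -E mulr_ge0.
  + move=> x Dx; rewrite fE fa => /addrI; rewrite -[- (rho * s)]mulrN.
    move=> H; have E := mulfI (lt0r_neq0 rho0) H.
    have b0 := mulr_ge0 s1' (D_beta_ge0 b Dx).
    apply/eqP; rewrite eq_le D_beta_le1//= -(ler_pM2l s_gt0); lra.
- rewrite ltrDl pmulr_rgt0// => s1_gt0 t /andP[zt tq].
  have rs0 : 0 < rho * (1 - s) by rewrite mulr_gt0.
  pose r := (z + rho * (1 - s) - t) / (z + rho * (1 - s) - z).
  have den : z + rho * (1 - s) - z = rho * (1 - s) by ring.
  have r01 : 0 <= r <= 1.
    rewrite /r den divr_ge0 ?subr_ge0// ?(ltW rs0)//=.
    by rewrite ler_pdivrMr// mul1r; lra.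
  have tE : t = r * z + (1 - r) * dotp (v b) theta.
    rewrite fb /r den; field; rewrite gt_eqF//=.
    by rewrite gt_eqF.
  rewrite -/r mulrC {1}tE; apply: level_vol_ray => //.
  + move=> x; rewrite fE => /(canRL (addKr _)); rewrite addNr => /eqP.
    rewrite mulf_eq0 gt_eqF//= subr_eq0 => /eqP E /(_ a); rewrite ab.
    by move=> /(_ isT) ax; rewrite -(pmulr_rge0 _ s1_gt0) E mulr_ge0.
  + move=> x Dx; rewrite fE fb => /addrI.
    move=> H; have E := mulfI (lt0r_neq0 rho0) H.
    have a0 := mulr_ge0 s0 (D_beta_ge0 a Dx).
    apply/eqP; rewrite eq_le D_beta_le1//= -(ler_pM2l s1_gt0); lra.
Qed.

End simplex_levels.
End simplices.

(** * Maximizing directions *)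

Section sphere.
Context {R : realType}.

Lemma derive1n_horner (q : {poly R}) k :
  ((horner q)^`(k))%classic = horner (q^`(k))%R.
Proof.
by elim: k => [//|k IH]; rewrite derive1nS IH derivnS derivE.
Qed.

Lemma class_C_horner (q : {poly R}) k : class_C k (horner q).
Proof.
split=> [j _ x|]; rewrite derive1n_horner.
  exact: derivable_horner.
exact: continuous_horner.
Qed.

Lemma class_C_C1 (phi : R -> R) k : (1 < k)%N -> class_C k phi -> C1 phi.
Proof.
move=> k1 [dphi _]; split=> [x|x]; first exact: (dphi 0%N (ltnW k1)).
apply/differentiable_continuous/derivable1_diffP.
by have := dphi 1%N k1 x; rewrite derive1n1.
Qed.

Lemma dotp_ge0 n (u : 'rV[R]_n) : 0 <= dotp u u.
Proof. by apply: sumr_ge0 => i _; rewrite -expr2 sqr_ge0. Qed.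

Lemma unit_sphereE n (u : 'rV[R]_n) : unit_sphere R n u <-> dotp u u = 1.
Proof.
rewrite /unit_sphere/= /eucl_norm; split=> [u1|->]; last exact: sqrtr1.
by rewrite -[LHS](sqr_sqrtr (dotp_ge0 u)) u1 expr1n.
Qed.

Lemma dotp_eq0 n (u : 'rV[R]_n) : (forall i, u ord0 i = 0) -> dotp u u = 0.
Proof. by move=> u0; rewrite /dotp big1// => i _; rewrite u0 mul0r. Qed.

Lemma dotp_neq0_coord n (u : 'rV[R]_n) : dotp u u != 0 ->
  exists i, u ord0 i != 0.
Proof.
move=> u0; apply: contrapT => /forallNP nu; case/eqP: u0; apply: dotp_eq0 => i.
by apply/eqP; apply: contrapT => /negP /nu.
Qed.

Lemma dotpZl n (a : R) (x u : 'rV[R]_n) : dotp (a *: x) u = a * dotp x u.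
Proof.
by rewrite /dotp mulr_sumr; apply: eq_bigr => i _; rewrite mxE mulrA.
Qed.

Lemma dotpZr n (a : R) (x u : 'rV[R]_n) : dotp x (a *: u) = a * dotp x u.
Proof.
by rewrite /dotp mulr_sumr; apply: eq_bigr => i _; rewrite mxE mulrCA.
Qed.

Definition normalize n (u : 'rV[R]_n) : 'rV[R]_n := (eucl_norm u)^-1 *: u.

Lemma eucl_norm_gt0 n (u : 'rV[R]_n) : dotp u u != 0 -> 0 < eucl_norm u.
Proof. by move=> u0; rewrite sqrtr_gt0 lt_neqAle eq_sym u0 dotp_ge0. Qed.

Lemma normalize_sphere n (u : 'rV[R]_n) : dotp u u != 0 ->
  unit_sphere R n (normalize u).
Proof.
move=> u0; apply/unit_sphereE; rewrite /normalize dotpZl dotpZr.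
have n0 := eucl_norm_gt0 u0.
rewrite -[X in _ * (_ * X)](sqr_sqrtr (dotp_ge0 u)) -/(eucl_norm u).
by field; rewrite gt_eqF.
Qed.

Lemma dotp_self_continuous n : continuous (fun u : 'rV[R]_n => dotp u u).
Proof.
move=> u; rewrite /dotp.
apply: (@cvg_big R _ +%R 0 xpredT (@add_continuous R) _ (nbhs u)) => i _.
by apply: cvgM; exact: coord_continuous.
Qed.

Lemma eucl_norm_continuous n : continuous (@eucl_norm R n).
Proof.
move=> u; apply: (continuous_comp (@dotp_self_continuous n u)).
exact: sqrt_continuous.
Qed.

Lemma normalize_continuous n (u : 'rV[R]_n) : dotp u u != 0 ->
  {for u, continuous (@normalize n)}.
Proof.
move=> u0.
have cV : (eucl_norm v)^-1 @[v --> u] --> (eucl_norm u)^-1.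
  apply: (@cvgV _ _ (nbhs u)); first by rewrite gt_eqF// eucl_norm_gt0.
  exact: eucl_norm_continuous.
exact: (@cvgZ _ _ _ (nbhs u) _ _ id _ u cV (@cvg_id _ (nbhs u))).
Qed.

Lemma unit_sphere_compact n : compact (unit_sphere R n).
Proof.
apply: bounded_closed_compact.
  exists 1; split=> // M M1 u /unit_sphereE u1.
  rewrite /= [leLHS]/Num.Def.normr/= mx_normrE; apply: bigmax_le => /=.
    by rewrite (le_trans ler01)// ltW.
  move=> [a i] _; rewrite (ord1 a)/= (le_trans _ (ltW M1))//.
  rewrite -(@expr_le1 _ 2)// real_normK ?num_real// -u1 /dotp (bigD1 i)//=.
  by rewrite -expr2 lerDl sumr_ge0// => j _; rewrite -expr2 sqr_ge0.
have -> : unit_sphere R n = (@eucl_norm R n) @^-1` [set x | x = 1] by [].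
apply: closed_comp; last exact: closed_eq.
by move=> u _; exact: eucl_norm_continuous.
Qed.

Lemma unit_sphere_nonempty n : (0 < n)%N -> unit_sphere R n !=set0.
Proof.
case: n => // n _; exists (delta_mx ord0 ord0); apply/unit_sphereE.
rewrite /dotp (bigD1 ord0)//= !mxE !eqxx mulr1 big1 ?addr0// => j j0.
by rewrite !mxE (negbTE j0) andbF mul0r.
Qed.

(** Continuity in the direction and compactness of the sphere; the expectations are finite because
    [phi] is bounded on the range of the form over [A]. *)
Lemma expectation_has_max n (A : set 'rV[R]_n) L d (T : measurableType d)
    (P : probability T R) (X : {RV P >-> 'rV[R]_n}) phi : (0 < n)%N ->
  measurable A -> A `<=` cube n L -> uniform_on A X -> C1 phi ->
  exists M, is_max_over (unit_sphere R n)
    (fun theta => 'E_P[fun t => phi (dotp (X t) theta)])%E M.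
Proof.
move=> n0 mA AL XA phi1.
have cm := mean_dotp_continuous mA AL XA phi1.
have cphi := C1_continuous phi1.
have [c cS cmax] := compact_EVT_max (unit_sphere_nonempty n0)
  (@unit_sphere_compact n) (continuous_subspaceT cm).
exists ('E_P[fun t => phi (dotp (X t) c)])%E; split.
  by exists c => //; exact: set_mem.
move=> u uS; rewrite !(expectation_dotp_fin mA AL XA _ cphi) lee_fin.
by apply: cmax; exact: mem_set.
Qed.

End sphere.

(** * Comparison in dimension at least two *)

Section extremal_directions.
Context {R : realType}.

Lemma isotropic_moments n (A B : set 'rV[R]_n) L L'
    d (T : measurableType d) (P : probability T R) (X : {RV P >-> 'rV[R]_n})
    d' (T' : measurableType d') (Q : probability T' R)
    (G : {RV Q >-> 'rV[R]_n}) (u u' : 'rV[R]_n) :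
  measurable A -> A `<=` cube n L -> uniform_on A X -> isotropic_rv X ->
  measurable B -> B `<=` cube n L' -> uniform_on B G -> isotropic_rv G ->
  unit_sphere R n u -> unit_sphere R n u' ->
  forall j, (j < 3)%N ->
    ('E_P[(fun y => y ^+ j)%R \o (fun t => dotp (X t) u)] =
     'E_Q[(fun y => y ^+ j)%R \o (fun t => dotp (G t) u')])%E.
Proof.
move=> mA AL XA Xi mB BL GB Gi /unit_sphereE u1 /unit_sphereE u1' j.
case: j => [|[|[|//]]] _.
- have one d0 (T0 : measurableType d0) (P0 : probability T0 R) (Y : T0 -> R) :
      ('E_P0[(fun y => y ^+ 0)%R \o Y] = 1)%E by exact: expectation_cst.
  by rewrite !one.
- exact: etrans (isotropic_mean mA AL XA Xi u)
    (esym (isotropic_mean mB BL GB Gi u')).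
- apply: etrans (isotropic_second_moment mA AL XA Xi u) _.
  by rewrite u1 -u1'; exact: esym (isotropic_second_moment mB BL GB Gi u').
Qed.

Lemma mean_dotpN n (A : set 'rV[R]_n) L d (T : measurableType d)
    (P : probability T R) (X : {RV P >-> 'rV[R]_n}) (phi : R -> R) u :
  measurable A -> A `<=` cube n L -> uniform_on A X -> C1 phi ->
  (forall y, phi (- y) = - phi y) ->
  mean P (fun t => phi (dotp (X t) (- u))) =
  - mean P (fun t => phi (dotp (X t) u)).
Proof.
move=> mA AL XA phi1 phiN; have cphi := C1_continuous phi1.
have [B hB] := dotp_bounded AL u cphi.
have mphi : measurable_fun setT (fun x => phi (dotp x u)).
  exact: (measurableT_comp (continuous_measurable_fun cphi) (measurable_dotp _)).
have iphi := uniform_integrable mA AL XA mphi hB.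
rewrite /mean !expectation.unlock.
transitivity (\int[P]_t (- 1 * phi (dotp (X t) u))).
  congr fine; apply: eq_integral => t _.
  by rewrite -scaleN1r dotpZr !mulN1r phiN.
by rewrite (RintegralZl (-1) measurableT iphi) mulN1r.
Qed.

Section high_dimension.
Variables (m : nat) (K : set 'rV[R]_m.+1) (L : R).
Hypotheses (m0 : (0 < m)%N) (mK : measurable K) (KL : K `<=` cube m.+1 L).
Hypothesis vK : convexV K.
Context d (T : measurableType d) (P : probability T R)
  (X : {RV P >-> 'rV[R]_m.+1}).
Hypotheses (XK : uniform_on K X) (Xiso : isotropic_rv X).
Variables (v w : 'I_m.+2 -> 'rV[R]_m.+1) (k : 'I_m.+2 -> R).
Hypothesis vw : forall i j, dotp (v j) (w i) + k i = (i == j)%:R.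
Hypothesis bary : forall x, \sum_i (dotp x (w i) + k i) = 1 /\
  x = \sum_i (dotp x (w i) + k i) *: v i.
Context d' (T' : measurableType d') (Q : probability T' R)
  (G : {RV Q >-> 'rV[R]_m.+1}).
Hypotheses (GD : uniform_on (convex_hull v) G) (Giso : isotropic_rv G).

Let D := convex_hull v.
Let mD : measurable D. Proof. exact: measurable_simplex vw bary. Qed.

(* The image of the simplex under this linear form has all vertices but [a]
   and [b] at one point, [v a] to its left and [v b] to its right. *)
Definition edge_form (a b : 'I_m.+2) (s : R) : 'rV[R]_m.+1 :=
  (1 - s) *: w b + (- s) *: w a.

(** The values of the form at [v b] and [v a] differ by [(1 - s) + s = 1], whatever [s] is. *)
Lemma edge_form_neq0 a b s : a != b ->
  dotp (edge_form a b s) (edge_form a b s) != 0.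
Proof.
move=> ab; set u := edge_form a b s; apply/eqP => u0.
have uz i : u ord0 i = 0.
  apply/eqP; rewrite -sqrf_eq0 eq_le sqr_ge0 andbT -u0 /dotp (bigD1 i)//=.
  by rewrite expr2 lerDl sumr_ge0// => j _; rewrite -expr2 sqr_ge0.
have dz x : dotp x u = 0.
  by rewrite /dotp big1// => i _; rewrite uz mulr0.
have vE i j : dotp (v j) (w i) = (i == j)%:R - k i by rewrite -vw addrK.
have := dz (v b); have := dz (v a).
rewrite /u /edge_form !dotpDr !vE !eqxx (negbTE ab) eq_sym (negbTE ab) /=.
by lra.
Qed.

Lemma edge_form_continuous a b : a != b ->
  continuous (fun s => normalize (edge_form a b s)).
Proof.
move=> ab s; apply: (@continuous_comp _ _ _ (edge_form a b) (@normalize R _)).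
  apply: (@cvgD _ _ _ (nbhs s)); apply: (@cvgZr_tmp _ _ _ (nbhs s)).
    by apply: (@cvgB _ R^o _ (nbhs s)); [exact: cvg_cst|exact: cvg_id].
  by apply: (@cvgN _ R^o _ (nbhs s)); exact: cvg_id.
exact/normalize_continuous/edge_form_neq0.
Qed.

Lemma body_density u : unit_sphere R m.+1 u -> exists F L', [/\
  has_density P (fun t => dotp (X t) u) F, power_concave m F &
  forall t, F t != 0 -> `|t| <= L'].
Proof.
move=> /unit_sphereE u1.
have [|i ui] := @dotp_neq0_coord R _ u; first by rewrite u1 oner_eq0.
have [c c0 Fd] := uniform_marginal mK KL XK ui.
exists (fun y => c * level_vol u i K y), (m.+1%:R * L * `|u|); split=> //.
  exact: (level_vol_power_concave mK KL c0 vK).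
move=> t; rewrite mulf_eq0 gt_eqF//=; exact: (level_vol_support ui KL).
Qed.

Lemma simplex_density a b s : a != b -> 0 <= s <= 1 ->
  exists F p z q C L', [/\
    has_density Q (fun t => dotp (G t) (normalize (edge_form a b s))) F,
    tent m p z q C F, 0 < C,
    [/\ p <= z <= q, p < q & s = 0 -> p = z] &
    forall t, F t != 0 -> `|t| <= L'].
Proof.
move=> ab s01; set u := normalize _; have /andP[s0 s1] := s01.
have e0 := edge_form_neq0 s ab.
have /unit_sphereE u1 := normalize_sphere e0.
have [|i ui] := @dotp_neq0_coord R _ u; first by rewrite u1 oner_eq0.
have [L' DL] := simplex_cube v.
have [c c0 Fd] := uniform_marginal mD DL GD ui.
pose rho := (eucl_norm (edge_form a b s))^-1.
have rho0 : 0 < rho by rewrite invr_gt0 eucl_norm_gt0.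
pose z := rho * (s * k a - (1 - s) * k b).
have := simplex_tent vw bary ui m0 ab s01 rho0 erefl (erefl z).
set V := level_vol u i D; set p := z - _; set q := z + _ => tV.
have V0 : 0 <= V z by exact: fine_ge0.
have rs : 0 <= rho * s by rewrite mulr_ge0// ltW.
have rs' : 0 <= rho * (1 - s) by rewrite mulr_ge0 ?subr_ge0// ltW.
(* If the peak were 0 the whole tent would vanish, and the density would have mass 0 instead of
   1. *)
have Vz : 0 < V z.
  rewrite lt_neqAle V0 andbT eq_sym; apply/eqP => Vz.
  have Vnull t : V t = 0.
    case: tV => [Vp Vq Vpz Vzq].
    have [tp|pt] := ltP t p; first exact: Vp.
    have [qt|tq] := ltP q t; first exact: Vq.
    have [tz|zt|->//] := ltgtP t z.
      by rewrite Vpz ?Vz ?mul0r// ?(le_lt_trans pt)// pt ltW.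
    by rewrite Vzq ?Vz ?mul0r// ?(lt_le_trans zt)// tq ltW.
  case: Fd => _ _ /(_ (cst 1) (@measurable_cst _ _ _ _ _ _)).
  rewrite (_ : cst 1 \o _ = cst 1)// expectation_cst integral0_eq.
    by move=> [] /eqP; rewrite oner_eq0.
  by move=> t _; rewrite -/V Vnull !mulr0.
exists (fun y => c * V y), p, z, q, (c * V z), (m.+1%:R * L' * `|u|); split=> //.
- case: tV => [Vp Vq Vpz Vzq]; split.
  + by move=> t tp; rewrite Vp// mulr0.
  + by move=> t tq; rewrite Vq// mulr0.
  + by move=> pz t tt; rewrite Vpz// mulrA.
  + by move=> zq t tt; rewrite Vzq// mulrA.
- by rewrite mulr_gt0.
- split.
  + by rewrite /p /q gerBl rs lerDl rs'.
  + by rewrite /p /q -subr_gt0 (_ : _ - _ = rho)//; ring.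
  + by move=> s00; rewrite /p s00 mulr0 subr0.
- move=> t; rewrite mulf_eq0 gt_eqF//=; exact: (level_vol_support ui DL).
Qed.

Let momentsE u u' := isotropic_moments (u := u) (u' := u')
  mK KL XK Xiso mD (projT2 (cid (simplex_cube v))) GD Giso.

(** The right side does not depend on [u]: at [s = 0] the form is [w b], normal to the facet
    opposite [v b]. *)
Lemma third_order_comparison u a b phi : a != b -> unit_sphere R m.+1 u ->
  class_C 3 phi -> (forall x, 0 < phi^`(3)%classic x) ->
  ('E_P[fun t => phi (dotp (X t) u)] <=
   'E_Q[fun t => phi (dotp (G t) (normalize (edge_form a b 0)))])%E.
Proof.
move=> ab u1 phi3 phi_gt0.
have [F [L1 [Fd FQ FL]]] := body_density u1.
have [|H [p [z [q [C [L2 [Hd tH C0 [pzq pq pz] HL]]]]]]] :=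
  @simplex_density a b 0 ab; first by rewrite lexx ler01.
move: tH pzq pq; rewrite (pz erefl) => tH pzq zq.
have [_ F0 _] := Fd.
have [s szs pat] := half_tent_pattern m0 C0 zq FQ F0 FL tH.
have FL' t : F t != 0 -> `|t| <= Num.max L1 L2.
  by move=> /FL tL; rewrite le_max tL.
have HL' t : H t != 0 -> `|t| <= Num.max L1 L2.
  by move=> /HL tL; rewrite le_max tL orbT.
apply: (density_comparison Fd Hd FL' HL' _ phi3 phi_gt0 _ szs pat) => //.
apply: momentsE => //; exact/normalize_sphere/edge_form_neq0.
Qed.

(** Written as a polynomial so that smoothness and the positive third derivative are read off
    polynomial derivatives. *)
Let cube_fun : R -> R := horner 'X^3.

Let cube_funE y : cube_fun y = y ^+ 3.
Proof. by rewrite /cube_fun hornerXn. Qed.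

Let third u : R := mean P (fun t => cube_fun (dotp (X t) u)).
Let third' u : R := mean Q (fun t => cube_fun (dotp (G t) u)).

Let third_le u a b : a != b -> unit_sphere R m.+1 u ->
  third u <= third' (normalize (edge_form a b 0)).
Proof.
move=> ab u1; have cc : continuous cube_fun by exact: continuous_horner.
have [L' DL] := simplex_cube v.
rewrite -lee_fin -(expectation_dotp_fin mK KL XK _ cc).
rewrite -(expectation_dotp_fin mD DL GD _ cc).
apply: third_order_comparison => //; first exact: class_C_horner.
move=> x; rewrite derive1n_horner derivnXn subnn expr0 hornerMn hornerC.
by rewrite ltr0n.
Qed.

Let third_eq u u' : third u = third' u' ->
  ('E_P[fun t => cube_fun (dotp (X t) u)] =
   'E_Q[fun t => cube_fun (dotp (G t) u')])%E.
Proof.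
move=> E; have cc : continuous cube_fun by exact: continuous_horner.
have [L' DL] := simplex_cube v.
rewrite (expectation_dotp_fin mK KL XK _ cc).
by rewrite (expectation_dotp_fin mD DL GD _ cc); congr EFin.
Qed.

Let matching_third_moment u a b : a != b -> unit_sphere R m.+1 u ->
  exists2 s, 0 <= s <= 1 & third u = third' (normalize (edge_form a b s)).
Proof.
move=> ab u1; have [L' DL] := simplex_cube v.
have cube1 : C1 cube_fun by apply: (@class_C_C1 _ _ 2); last exact: class_C_horner.
have cubeN y : cube_fun (- y) = - cube_fun y by rewrite !cube_funE; ring.
pose g s := third' (normalize (edge_form a b s)).
have cg : continuous g.
  move=> s; apply: (@continuous_comp _ _ _
    (fun s => normalize (edge_form a b s)) third').
    exact: edge_form_continuous.
  exact: (mean_dotp_continuous mD DL GD cube1).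
have g0 : third u <= g 0 by exact: third_le.
(* At [s = 1] the form is [- w a], the opposite of the facet normal [edge_form b a 0]. Applying the
   upper bound to [- u] and using that the cube is odd gives the lower bound for [u]. *)
have g1 : g 1 <= third u.
  have u1N : unit_sphere R m.+1 (- u).
    by apply/unit_sphereE; rewrite -scaleN1r dotpZl dotpZr mulrA mulrNN !mul1r;
      exact/unit_sphereE.
  have ba : b != a by rewrite eq_sym.
  have := third_le ba u1N.
  have e10 : edge_form b a 0 = - edge_form a b 1.
    by apply/rowP => i; rewrite !mxE; ring.
  have -> : normalize (edge_form b a 0) = - normalize (edge_form a b 1).
    rewrite /normalize e10 scalerN /eucl_norm -[- edge_form a b 1]scaleN1r.
    by rewrite dotpZl dotpZr mulrA mulrNN !mul1r.
  rewrite /third /third' (mean_dotpN _ mK KL XK cube1 cubeN).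
  by rewrite (mean_dotpN _ mD DL GD cube1 cubeN) lerN2.
have [||s] := @IVT R g 0 1 (third u) ler01.
- exact: continuous_subspaceT.
- rewrite ge_min g1 orbT /=; rewrite le_max g0//.
by rewrite in_itv/= => s01 <-; exists s.
Qed.

Lemma fourth_order_comparison u phi : unit_sphere R m.+1 u ->
  class_C 4 phi -> (forall x, 0 < phi^`(4)%classic x) ->
  exists2 u', unit_sphere R m.+1 u' &
    ('E_P[fun t => phi (dotp (X t) u)] <=
     'E_Q[fun t => phi (dotp (G t) u')])%E.
Proof.
move=> u1 phi4 phi_gt0.
have ab : (ord0 : 'I_m.+2) != ord_max by [].
have [s s01 us] := matching_third_moment ab u1.
exists (normalize (edge_form ord0 ord_max s)).
  exact/normalize_sphere/edge_form_neq0.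
have [F [L1 [Fd FQ FL]]] := body_density u1.
have [H [p [z [q [C [L2 [Hd tH C0 [pzq pq _] HL]]]]]]] := simplex_density ab s01.
have [_ F0 _] := Fd.
have [r szr pat] := tent_pattern m0 C0 pzq pq FQ F0 FL tH.
have FL' t : F t != 0 -> `|t| <= Num.max L1 L2.
  by move=> /FL tL; rewrite le_max tL.
have HL' t : H t != 0 -> `|t| <= Num.max L1 L2.
  by move=> /HL tL; rewrite le_max tL orbT.
apply: (density_comparison Fd Hd FL' HL' _ phi4 phi_gt0 _ szr pat) => // j.
rewrite ltnS leq_eqVlt => /orP[/eqP->|j3].
  have := third_eq us; rewrite (_ : cube_fun = (fun y => y ^+ 3))//.
  by apply/funext => y; exact: cube_funE.
apply: momentsE => //; exact/normalize_sphere/edge_form_neq0.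
Qed.

End high_dimension.
End extremal_directions.

(** * Dimension one, and the assembly of all cases *)

Section dimension_one.
Context {R : realType}.

(** Slices live in dimension 0, where a set has measure 0 or 1 according to whether it contains the
    only point; so the density is [c] times an indicator. *)
Lemma interval_marginal (A : set 'rV[R]_1) L (u : 'rV[R]_1)
    d (T : measurableType d) (P : probability T R) (X : {RV P >-> 'rV[R]_1}) :
  measurable A -> A `<=` cube 1 L -> convexV A -> uniform_on A X ->
  unit_sphere R 1 u ->
  exists (c : R) (F : R -> R) (I : set R) (L' : R), [/\
    has_density P (fun t => dotp (X t) u) F, 0 <= c,
    (forall t, I t -> F t = c) /\ (forall t, ~ I t -> F t = 0),
    forall x y t, I x -> I y -> x < t < y -> I t &
    (forall t, I t -> `|t| <= L') /\ (forall t, F t != 0 -> `|t| <= L')].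
Proof.
move=> mA AL vA XA /unit_sphereE u1.
have [|i ui] := @dotp_neq0_coord R _ u; first by rewrite u1 oner_eq0.
have [c c0 Fd] := uniform_marginal mA AL XA ui.
have supp := level_vol_support ui AL.
pose I := [set y | level u i A y 0].
have FI t : I t -> level_vol u i A t = 1.
  by move=> It; rewrite /level_vol; case: (lebesgue_rV0 (level u i A t)) => -[? ->].
have FnI t : ~ I t -> level_vol u i A t = 0.
  by move=> It; rewrite /level_vol; case: (lebesgue_rV0 (level u i A t)) => -[? ->].
exists c, (fun y => c * level_vol u i A y), I, (1%:R * L * `|u|); split=> //.
- exact: ltW.
- by split=> t It; [rewrite FI// mulr1|rewrite FnI// mulr0].
- move=> x y t Ix Iy /andP[xt ty].
  pose l := (t - x) / (y - x).
  have yx : 0 < y - x by rewrite subr_gt0; exact: lt_trans ty.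
  have l0 : 0 < l by rewrite divr_gt0// subr_gt0.
  have l1 : l < 1 by rewrite ltr_pdivrMr// mul1r ltrD2r.
  have -> : t = (1 - l) * x + l * y.
    have : l * (y - x) = t - x by rewrite divfK// gt_eqF.
    lra.
  have := vA l _ _ _ Ix Iy; rewrite -slab_affine !scaler0 addr0; apply.
  by rewrite l0.
- split=> t; first by move=> It; apply: supp; rewrite FI// oner_eq0.
  by rewrite mulf_eq0 gt_eqF//=; exact: supp.
Qed.

(** Tents degenerate for exponent 0. Instead, two indicators of intervals change order at most twice
    while three moments agree, which gives equality; the higher one takes the first place in the
    comparison. *)
Lemma dimension_one (A B : set 'rV[R]_1) L L'
    d (T : measurableType d) (P : probability T R) (X : {RV P >-> 'rV[R]_1})
    d' (T' : measurableType d') (Q : probability T' R)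
    (G : {RV Q >-> 'rV[R]_1}) (u : 'rV[R]_1) (phi : R -> R) :
  measurable A -> A `<=` cube 1 L -> convexV A -> uniform_on A X ->
  isotropic_rv X ->
  measurable B -> B `<=` cube 1 L' -> convexV B -> uniform_on B G ->
  isotropic_rv G ->
  unit_sphere R 1 u -> continuous phi ->
  ('E_P[fun t => phi (dotp (X t) u)] = 'E_Q[fun t => phi (dotp (G t) u)])%E.
Proof.
move=> mA AL vA XA Xi mB BL vB GB Gi u1 cphi.
have mom := isotropic_moments mA AL XA Xi mB BL GB Gi u1 u1.
have [a [F [I [L1 [Fd a0 [FI FnI] Ic [IL FL]]]]]] :=
  interval_marginal mA AL vA XA u1.
have [b [H [J [L2 [Hd b0 [HJ HnJ] Jc [JL HL]]]]]] :=
  interval_marginal mB BL vB GB u1.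
have FL' t : F t != 0 -> `|t| <= Num.max L1 L2.
  by move=> /FL tL; rewrite le_max tL.
have HL' t : H t != 0 -> `|t| <= Num.max L1 L2.
  by move=> /HL tL; rewrite le_max tL orbT.
have [ab|/ltW ba] := leP a b.
  have [s szs pat] := interval_indicator_pattern ab a0 HJ HnJ FI FnI Jc JL.
  symmetry; apply: (density_rigidity Hd Fd HL' FL' cphi _ pat) => j.
  by rewrite szs => j3; rewrite mom.
have [s szs pat] := interval_indicator_pattern ba b0 FI FnI HJ HnJ Ic IL.
apply: (density_rigidity Fd Hd FL' HL' cphi _ pat) => j.
by rewrite szs => j3; exact: mom.
Qed.

Lemma convex_setV n (K : set 'rV[R]_n) :
  convex_set (K : set (convex_lmodType 'rV[R]_n)) -> convexV K.
Proof.
move=> cK l x y /andP[l0 l1] Kx Ky.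
(* [convex_set] puts the given weight on the first point, here [x]; [l] comes back as
   [1 - (1 - l)]. *)
have l01 : Itv.spec (@Itv.num_sem R) (Itv.Real `[0%Z, 1%Z]) (1 - l).
  by rewrite /= /Itv.num_sem/= in_itv/= num_real subr_ge0 ltW//= gerBl ltW.
have := cK x y (Itv.mk l01) (mem_set Kx) (mem_set Ky).
move=> /set_mem KE; suff -> : l *: y = (1 - (1 - l)) *: y by exact: KE.
by rewrite subKr.
Qed.

End dimension_one.

Unset Implicit Arguments.

Theorem theorem3 (R : realType) (n : nat) (n_gt0 : (0 < n)%N)
    (K : set 'rV[R]_n) (K_body : convex_body K) (K_iso : isotropic_body K)
    (d : measure_display) (T : measurableType d) (P : probability T R)
    (X : {RV P >-> 'rV[R]_n}) (X_unif : uniform_on K X)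
    (D : set 'rV[R]_n) (D_simplex : full_simplex D) (D_iso : isotropic_body D)
    (d' : measure_display) (T' : measurableType d') (Q : probability T' R)
    (G : {RV Q >-> 'rV[R]_n}) (G_unif : uniform_on D G)
    (k : nat) (k34 : k = 3%N \/ k = 4%N)
    (phi : R -> R) (phi_Ck : class_C k phi) (phi_pos : forall x, 0 < derive1n k phi x) :
  exists M N : \bar R,
    [/\ is_max_over (unit_sphere R n)
          (fun theta => 'E_P[fun t => phi (dotp (X t) theta)])%E M,
        is_max_over (unit_sphere R n)
          (fun theta => 'E_Q[fun t => phi (dotp (G t) theta)])%E N
      & (M <= N)%E].
Proof.
have [cK convK _] := K_body.
have mK := compact_measurable_rV cK.
have [L KL] := compact_cube cK.
have vK := convex_setV convK.
have Xi := K_iso _ _ _ X X_unif; have Gi := D_iso _ _ _ G G_unif.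
case: D_simplex => v [vi DE]; subst D; have GD := G_unif.
have [w [c [vw bary]]] := barycentric_coordinates vi.
have mD := measurable_simplex vw bary.
have vD := simplex_convex vw bary.
have [L' DL] := simplex_cube v.
have phi1 : C1 phi by apply: class_C_C1 phi_Ck; case: k34 => ->.
have [M MP] := expectation_has_max n_gt0 mK KL X_unif phi1.
have [N NQ] := expectation_has_max n_gt0 mD DL GD phi1.
exists M, N; split=> //.
(* It suffices to dominate the value at a maximizer [u] for [X] by the value for [G] at some [u'],
   which may depend on [u]. *)
case: MP => -[u u1 <-] _; case: NQ => _ leN.
suff [u' u1' uu'] : exists2 u', unit_sphere R n u' &
    ('E_P[fun t => phi (dotp (X t) u)] <=
     'E_Q[fun t => phi (dotp (G t) u')])%E.
  exact: le_trans uu' (leN _ u1').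
clear K_body K_iso cK convK G_unif D_iso leN.
case: n n_gt0 K X X_unif v vi G GD mK KL vK Xi Gi w c vw bary mD vD DL u u1 =>
  [//|[|m]] _ K X X_unif v vi G GD mK KL vK Xi Gi w c vw bary mD vD DL u u1.
  exists u => //; rewrite (dimension_one mK KL vK X_unif Xi mD DL vD GD Gi u1)//.
  exact: C1_continuous.
case: k34 => kE; rewrite kE in phi_Ck phi_pos; last first.
  exact: (fourth_order_comparison (ltn0Sn m) mK KL vK X_unif Xi vw bary GD Gi u1
    phi_Ck phi_pos).
exists (normalize (edge_form w ord0 ord_max 0)).
  exact/normalize_sphere/(edge_form_neq0 vw).
exact: (third_order_comparison (ltn0Sn m) mK KL vK X_unif Xi vw bary GD Gi _ u1
  phi_Ck phi_pos).
Qed.
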